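(* Let $P$ be a submonoid of a group $G$, let $G \curvearrowright \partial\Omega$ be its boundary (partial) action, and let $G^c := \{ g \in G : (pP) \cap (gpP) \neq \emptyset \text{ for all } p \in P\}$. Then $G \curvearrowright \partial \Omega$ is topologically free if and only if $G^c$ is the trivial group $\{1\}$. In this case, $\partial C^*_{\lambda}(P)$ is simple, and $\partial C^*_{\lambda}(P)$ is purely infinite simple unless $P$ is the trivial monoid.
   Context: Each $p\in P$ defines the partial bijection $P \to pP$, $x \mapsto px$, of $P$. The left inverse hull $I_l$ is the smallest semigroup of partial bijections of $P$ containing these and closed under inverses. $\mathcal J := \{\mathrm{dom}(s) : s \in I_l\}$ is its semilattice of idempotents (an idempotent is identified with its domain; multiplication is intersection, order is inclusion). $\widehat{\mathcal J}$ is the space of non-zero multiplicative maps $\chi : \mathcal J \to \{0,1\}$, with $\chi(\emptyset)=0$ in case $\emptyset \in \mathcal J$, with the topology of pointwise convergence. $\widehat{\mathcal J}_{\max} = \Omega_{\max}$ is the set of those $\chi$ for which $\chi^{-1}(1)$ is maximal with respect to inclusion among all $\chi^{-1}(1)$, $\chi\in\widehat{\mathcal J}$, and the boundary is the closure $\partial\Omega := \overline{\Omega_{\max}}$ in $\widehat{\mathcal J}$. For every non-empty $s \in I_l$ there is a unique $\sigma(s)\in G$ with $s(x)=\sigma(s)x$ for all $x\in \mathrm{dom}(s)$. For $g\in G$ let $U_{g^{-1}}$ be the set of all $\chi\in\widehat{\mathcal J}$ such that $\chi(s^{-1}s)=1$ for some non-empty $s\in I_l$ with $\sigma(s)=g$.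 The partial action of $G$ is given by the homeomorphisms $U_{g^{-1}} \to U_g$, $\chi\mapsto g.\chi := \chi(s^{-1}\,\cdot\, s)$ for any such $s$ (with $\chi(s^{-1}s)=1$). It restricts to a partial action of $G$ on $\partial\Omega$, called the boundary action, with domains $U_{g^{-1}}\cap\partial\Omega$. It is topologically free if for every $1\neq g\in G$ the set $\{\chi\in U_{g^{-1}}\cap\partial\Omega : g.\chi\neq\chi\}$ is dense in $U_{g^{-1}}\cap\partial\Omega$. $\partial C^*_\lambda(P)$ is the reduced C*-algebra of the partial transformation groupoid $G\ltimes\partial\Omega$, i.e. the reduced partial crossed product $C(\partial\Omega)\rtimes_r G$. *)

(* Defs.v *)
From HB Require Import structures.
From mathcomp Require Import all_boot all_order all_algebra.
From mathcomp Require Import all_classical all_reals all_analysis.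
From mathcomp Require Import complex ring.
From mathcomp.analysis Require showcase.summability.

Set Implicit Arguments.
Unset Strict Implicit.
Unset Printing Implicit Defensive.

Import Order.TTheory GRing.Theory Num.Theory.
Import numFieldNormedType.Exports.

Local Open Scope classical_set_scope.

Section LeftInverseHull.
Local Open Scope group_scope.
Variables (G : groupType) (P : set G).

(* Partial bijections of P are represented by their graphs, subsets of P * P.
   In the relational notation [s \; t] is "first t, then s". *)
Inductive left_inverse_hull : set (set (G * G)) :=
| lih_mul p : P p -> left_inverse_hull [set xy | P xy.1 /\ xy.2 = p * xy.1]
| lih_inv s : left_inverse_hull s -> left_inverse_hull (s^-1)%relation
| lih_comp s t : left_inverse_hull s -> left_inverse_hull t ->
    left_inverse_hull (s \; t)%relation.

Definition pdom (s : set (G * G)) : set G := [set xy.1 | xy in s].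

Definition constructible : set (set G) :=
  [set pdom s | s in left_inverse_hull].

(* [sigma_eq s g] is sigma(s) = g, for non-empty s. *)
Definition sigma_eq (s : set (G * G)) (g : G) : Prop :=
  s !=set0 /\ forall xy, s xy -> xy.2 = g * xy.1.

Lemma left_inverse_hull_inj s : left_inverse_hull s ->
  (forall x y z, s (x, y) -> s (x, z) -> y = z) /\
  (forall x y z, s (x, z) -> s (y, z) -> x = y).
Proof.
elim => [p _|{}s _ [h1 h2]|{}s t _ [s1 s2] _ [t1 t2]] /=.
- split=> [x y z [_ /= ->] [_ /= ->]//|x y z /= [_ ->] [_] /mulgI //].
- by split=> x y z; [apply: h2|apply: h1].
- split=> x y z /= [u tu su] [v tv sv].
    by move: sv; rewrite -(t1 _ _ _ tu tv); apply: s1.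
  by move: tv; rewrite -(s2 _ _ _ su sv); apply: t2.
Qed.

Lemma constructible_preimage s X : left_inverse_hull s -> constructible X ->
  constructible [set x | exists2 y, s (x, y) & X y].
Proof.
move=> hs [t ht <-]; exists (t \; s)%relation; first exact: lih_comp.
apply/seteqP; split=> [x [[x' z] [y sy tz] /= <-]|x [y sy [[y' z] tz /= yy']]].
  by exists y => //; exists (y, z).
by exists (x, z) => //; exists y => //; rewrite -yy'.
Qed.

Lemma constructibleI X Y :
  constructible X -> constructible Y -> constructible (X `&` Y).
Proof.
move=> [s hs <-] hY; have [_ injs] := left_inverse_hull_inj hs.
suff -> : pdom s `&` Y =
    [set x | exists2 y, (s^-1 \; s)%relation (x, y) & Y y].
  by apply: constructible_preimage => //; apply: lih_comp => //; apply: lih_inv.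
apply/seteqP; split=> x.
  by move=> [[[x' y] sxy /= <-] Yx]; exists x' => //; exists y.
move=> [y [z /= sxz syz] Yy]; rewrite (injs _ _ _ sxz syz); split=> //.
by exists (y, z).
Qed.

Definition cset := set_type constructible.

Definition csetI (X Y : cset) : cset :=
  SigSub (mem_set (constructibleI (set_valP X) (set_valP Y))).

Definition cdom s (hs : left_inverse_hull s) : cset :=
  SigSub (mem_set (ex_intro2 _ _ s hs erefl)).

(* The idempotent s^-1 X s, i.e. the set of x in dom(s) with s(x) in X. *)
Definition cpre s (hs : left_inverse_hull s) (X : cset) : cset :=
  SigSub (mem_set (constructible_preimage hs (set_valP X))).

Definition charJ := {ptws cset -> bool}.

Definition Jhat : set charJ :=
  [set chi : charJ | [/\ exists X, chi X,
                 forall X Y, chi (csetI X Y) = chi X && chi Y &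
                 forall X, set_val X = set0 -> chi X = false]].

Definition Omega_max : set charJ :=
  [set chi : charJ | Jhat chi /\
    forall psi : charJ, Jhat psi -> [set X | chi X] `<=` [set X | psi X] ->
      [set X | psi X] = [set X | chi X]].

Definition boundary : set charJ := Jhat `&` closure Omega_max.

(* [act_dom g] is the domain U_{g^-1} of chi |-> g.chi on Jhat. *)
Definition act_dom (g : G) : set charJ :=
  [set chi : charJ | Jhat chi /\
    exists s (hs : left_inverse_hull s), sigma_eq s g /\ chi (cdom hs)].

(* The value chi(s^-1 X s) does not depend on s: see [actE]. *)
Definition act (g : G) (chi : charJ) : charJ := fun X =>
  `[< exists s (hs : left_inverse_hull s),
        [/\ sigma_eq s g, chi (cdom hs) & chi (cpre hs X)] >].

Lemma actE g chi s (hs : left_inverse_hull s) X : Jhat chi ->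
  sigma_eq s g -> chi (cdom hs) -> act g chi X = chi (cpre hs X).
Proof.
move=> [_ chiI _] sg cs; apply/asboolP/idP => [[t [ht [tg ct ctX]]]|cX].
  have: chi (csetI (cdom hs) (cpre ht X)) by rewrite chiI cs.
  suff -> : csetI (cdom hs) (cpre ht X) = csetI (cdom ht) (cpre hs X).
    by rewrite chiI => /andP[].
  apply: val_inj; apply/seteqP; split=> x /=.
  - move=> [[[x' y] sxy /= xx'] [z tz Xz]]; rewrite xx' in sxy.
    split; first by exists (x, z).
    exists y => //; have /= -> := sg.2 _ sxy; by have /= <- := tg.2 _ tz.
  - move=> [[[x' y] sxy /= xx'] [z tz Xz]]; rewrite xx' in sxy.
    split; first by exists (x, z).
    exists y => //; have /= -> := tg.2 _ sxy; by have /= <- := sg.2 _ tz.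
by exists s, hs.
Qed.

Definition topologically_free : Prop :=
  forall g : G, g <> 1 ->
    act_dom g `&` boundary `<=`
      closure [set chi : charJ | (act_dom g `&` boundary) chi /\ act g chi <> chi].

Definition Gc : set G :=
  [set g | forall p, P p ->
    [set p * x | x in P] `&` [set g * p * x | x in P] !=set0].

(* The arrow (g, chi) has source chi and range g.chi. *)
Definition boundary_groupoid : set (discrete_topology G * charJ) :=
  [set a | (act_dom a.1 `&` boundary) a.2].

End LeftInverseHull.

Arguments boundary_groupoid {G} P _.

Local Open Scope ring_scope.

Section Ell2.
Variables (R : realType) (X : choiceType).

Definition sqnorm (xi : X -> R[i]) : \bar R :=
  \esum_(x in [set: X]) ((ComplexField.Normc.normc (xi x)) ^+ 2)%:E.

Definition square_summable : {pred X -> R[i]} :=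
  fun xi => `[< (sqnorm xi < +oo)%E >].

Local Notation nrm := ComplexField.Normc.normc.

Lemma normcD_sqr (a b : R[i]) :
  nrm (a + b) ^+ 2 <= 2 * nrm a ^+ 2 + 2 * nrm b ^+ 2.
Proof.
case: a b => [a1 a2] [b1 b2] /=.
rewrite !sqr_sqrtr ?addr_ge0 ?sqr_ge0 // -subr_ge0.
rewrite (_ : _ - _ = (a1 - b1) ^+ 2 + (a2 - b2) ^+ 2); last by ring.
by rewrite addr_ge0 ?sqr_ge0.
Qed.

Lemma square_summable_submod : submod_closed square_summable.
Proof.
split.
  apply/asboolP; rewrite /sqnorm esum1 ?ltry // => x _.
  by rewrite ComplexField.Normc.normc0 expr0n.
move=> a u v /asboolP hu /asboolP hv; apply/asboolP.
pose M := 2 * nrm a ^+ 2.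
have M0 : 0 <= M by rewrite mulr_ge0 // sqr_ge0.
have n0 (w : X -> R[i]) x : (0 <= (nrm (w x) ^+ 2)%:E)%E.
  by rewrite lee_fin sqr_ge0.
have leZ (c : R) (w : X -> R[i]) : 0 <= c ->
    (\esum_(x in [set: X]) (c%:E * (nrm (w x) ^+ 2)%:E) <= c%:E * sqnorm w)%E.
  move=> c0; apply: ge_ereal_sup => _ [F [finF _] <-].
  rewrite -ge0_mule_fsumr //.
  by apply: lee_wpmul2l; [rewrite lee_fin|apply: esum_ge; exists F].
apply: (@le_lt_trans _ _ (M%:E * sqnorm u + 2%:E * sqnorm v)%E).
  apply: (@le_trans _ _ (\esum_(x in [set: X])
      (M%:E * (nrm (u x) ^+ 2)%:E + 2%:E * (nrm (v x) ^+ 2)%:E))%E).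
    apply: le_esum => x _; rewrite -!EFinM -EFinD lee_fin.
    by rewrite (le_trans (normcD_sqr _ _)) // ComplexField.Normc.normcM exprMn mulrA.
  rewrite esumD; first by apply: leeD; apply: leZ.
  - by move=> x _; rewrite mule_ge0 // lee_fin.
  - by move=> x _; rewrite mule_ge0 // lee_fin.
have fin (c : R) (w : X -> R[i]) : 0 <= c -> (sqnorm w < +oo)%E ->
    (c%:E * sqnorm w < +oo)%E.
  move=> c0 hw; rewrite -ge0_fin_numE ?mule_ge0 ?lee_fin ?esum_ge0 //.
  by rewrite fin_numM // ge0_fin_numE // esum_ge0.
by apply: lte_add_pinfty; apply: fin.
Qed.

HB.instance Definition _ :=
  GRing.isSubmodClosed.Build R[i] (X -> R[i]) square_summable
    square_summable_submod.

Record ell2 := Ell2 { ell2_val :> X -> R[i]; _ : ell2_val \in square_summable }.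

HB.instance Definition _ := [isSub for ell2_val].
HB.instance Definition _ := [Choice of ell2 by <:].
HB.instance Definition _ := [SubChoice_isSubLmodule of ell2 by <:].

(* Operators are plain functions [ell2 -> ell2], with the pointwise vector space
   structure and composition as product; the C*-algebras below are concrete
   norm-closed *-subalgebras of the bounded operators on ell2. *)
Definition ell2_norm (xi : ell2) : R := Num.sqrt (fine (sqnorm xi)).

Definition ell2_dot (xi eta : ell2) : R[i] :=
  showcase.summability.sum (R := R[i]^o) (fun x => xi x * (eta x)^*).

Definition bounded_op (T : ell2 -> ell2) : Prop :=
  linear T /\ exists M, forall xi, ell2_norm (T xi) <= M * ell2_norm xi.

Definition opnorm (T : ell2 -> ell2) : R :=
  inf [set M | 0 <= M /\ forall xi, ell2_norm (T xi) <= M * ell2_norm xi].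

Definition is_adjoint (T S : ell2 -> ell2) : Prop :=
  forall xi eta, ell2_dot (T xi) eta = ell2_dot xi (S eta).

Definition norm_closure (A : set (ell2 -> ell2)) : set (ell2 -> ell2) :=
  [set T | bounded_op T /\
    forall e : R, 0 < e -> exists S, A S /\ opnorm (T - S) < e].

Definition closed_subspace (A : set (ell2 -> ell2)) : Prop :=
  [/\ A `<=` bounded_op, A 0,
      forall a b, A a -> A b -> A (a + b),
      forall (c : R[i]) a, A a -> A (c *: a) &
      norm_closure A `<=` A].

Definition Cstar_algebra (A : set (ell2 -> ell2)) : Prop :=
  [/\ closed_subspace A,
      forall a b, A a -> A b -> A (a \o b) &
      forall a, A a -> exists2 b, A b & is_adjoint a b].

Definition closed_ideal (A I : set (ell2 -> ell2)) : Prop :=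
  [/\ closed_subspace I, I `<=` A,
      forall a b, A a -> I b -> I (a \o b) &
      forall a b, I a -> A b -> I (a \o b)].

Definition Cstar_simple (A : set (ell2 -> ell2)) : Prop :=
  (exists2 a, A a & a <> 0) /\
  forall I, closed_ideal A I -> I = [set 0] \/ I = A.

(* a = c^* c with c in A. *)
Definition positive_in (A : set (ell2 -> ell2)) (a : ell2 -> ell2) : Prop :=
  exists c d, [/\ A c, A d, is_adjoint c d & a = d \o c].

Definition hereditary_subalgebra (A B : set (ell2 -> ell2)) : Prop :=
  [/\ Cstar_algebra B, B `<=` A &
      forall a b, B b -> positive_in A a -> positive_in A (b - a) -> B a].

Definition projection (p : ell2 -> ell2) : Prop :=
  p \o p = p /\ is_adjoint p p.

(* p = v^* v is Murray-von Neumann equivalent, in A, to the proper subprojection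
   v v^*. *)
Definition infinite_projection (A : set (ell2 -> ell2))
    (p : ell2 -> ell2) : Prop :=
  [/\ A p, projection p &
    exists v w, [/\ A v, A w, is_adjoint v w, w \o v = p &
      p \o (v \o w) = v \o w /\ v \o w <> p]].

Definition purely_infinite_simple (A : set (ell2 -> ell2)) : Prop :=
  Cstar_simple A /\
  forall B, hereditary_subalgebra A B -> (exists2 b, B b & b <> 0) ->
    exists2 p, B p & infinite_projection A p.

End Ell2.

Section BoundaryAlgebra.
Variables (R : realType) (G : groupType) (P : set G).

Definition arrow := set_type (boundary_groupoid P).

(* C_c of the groupoid, its elements being extended by 0 to all pairs. *)
Definition groupoid_Cc : set (discrete_topology G * charJ P -> R[i]^o) :=
  [set f | {within boundary_groupoid P, continuous f} /\
    exists K, [/\ compact K, K `<=` boundary_groupoid P &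
                  forall a, ~ K a -> f a = 0]].

(* T is left convolution by f, i.e. the sum over all chi in the boundary of the
   regular representations of f on the l^2-spaces of the source fibres over chi:
   (T xi)(c) is the sum over b with the same source as c of f(c b^-1) xi(b),
   and for c = (g, chi) and b = (k, chi) the arrow c b^-1 is (g k^-1, k.chi). *)
Definition convolution_op (f : discrete_topology G * charJ P -> R[i]^o)
    (T : ell2 R arrow -> ell2 R arrow) : Prop :=
  forall (xi : ell2 R arrow) (c : arrow), T xi c =
    \sum_(b \in [set b : arrow | (set_val b).2 = (set_val c).2])
      f (((set_val c).1 * (set_val b).1^-1)%g,
         act (set_val b).1 (set_val b).2) * xi b.

(* Norm closure of the regular representation of C_c of the groupoid on
   l^2 of the groupoid, the direct sum over the units chi of the l^2-spaces of
   the source fibres. *)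
Definition boundary_algebra : set (ell2 R arrow -> ell2 R arrow) :=
  norm_closure [set T | bounded_op T /\
    exists2 f, groupoid_Cc f & convolution_op f T].

End BoundaryAlgebra.

Arguments boundary_algebra R {G} P _.

(* Main.v *)
From HB Require Import structures.
Require Import Defs.
From mathcomp Require Import all_boot all_order all_algebra finmap.
From mathcomp Require Import all_classical all_reals all_analysis.
From mathcomp Require Import complex ring lra.
From mathcomp.analysis Require showcase.summability.

(* For p in P let v_p be the isometry of l^2(arrows) that translates the arrows
   by p; both v_p and v_p^* lie in the boundary algebra A. Characters in the
   boundary are limits of maximal ones, and a maximal character chi with
   chi(Y) = 0 satisfies chi(Z) = 1 for some Z disjoint from Y. Hence every
   non-empty open subset of the boundary contains {chi | chi(pP) = 1} for some p
   in P. If G^c is trivial then for every g <> 1 and p there is q in P such that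
   pqP and gpqP are disjoint. Given T in A with a matrix coefficient lam <> 0,
   approximate T by convolution by some f in C_c, use the first fact to make f
   nearly constant near the corresponding arrow, and the second one, finitely
   often, to remove the other group elements in the support of f: this yields p, q
   in P such that v_q^* T v_p is close to the scalar lam, with q = p for a diagonal
   coefficient.

   So every non-zero ideal of A contains an element close to 1. For a hereditary
   subalgebra B and 0 <> b in B this gives, after scaling, b^* b with
   v_p^* b^* b v_p = 1 - x and x small; if z = z^* satisfies z (1 - x) z = 1, then
   u = b v_p z is an isometry, u u^* is in B, and u v_r u^* shows that the
   projection u u^* is infinite as soon as v_r is not unitary.

   For the first equivalence, G^c fixes all maximal characters in its domain,
   and conversely a character with chi(pqP) = 1 is moved by g when pqP and gpqP
   are disjoint. *)

Set Implicit Arguments.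
Unset Strict Implicit.
Unset Printing Implicit Defensive.

Import Order.TTheory GRing.Theory Num.Theory.
Import numFieldNormedType.Exports.

Local Open Scope classical_set_scope.
Local Open Scope ring_scope.

(** * Square-summable families *)

Section Ell2Norm.
Variables (R : realType) (X : choiceType).
Local Notation C := R[i].
Local Notation nrm := (@ComplexField.Normc.normc R).
Local Notation L2 := (ell2 R X).
Implicit Types (xi eta : L2) (J : {fset X}).

(** For p in P the map chi |-> p.chi is defined on the whole boundary and takes values in {chi |
    chi(pP) = 1}. So v_p is isometric on all of l^2, and a compression v_q^* T v_p involves T only
    over this small set. This is how information about f near a single arrow becomes an estimate for
    an operator on all of l^2. A coefficient over g leads to q = g p. This product is in P because p
    can be chosen in the domain of some s in the left inverse hull with sigma(s) = g. Off-diagonal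
    coefficients are therefore as good as diagonal ones, and simplicity needs no faithful
    conditional expectation. Pure infiniteness does need q = p, which the positive element b^* b
    provides: each of its non-zero columns has a non-zero diagonal coefficient. Operators are bare
    functions on l^2, so spectral theory is replaced by explicit limits: z is the fixed point of a
    contraction, and u u^* is a limit of polynomials in b v_p v_p^* b^*, an element of B by
    heredity. Both arguments rest on the completeness of l^2. *)

Lemma normc_ge0 (z : C) : 0 <= nrm z.
Proof. by case: z => a b; rewrite /= sqrtr_ge0. Qed.

Lemma normc_complex (a : R) : nrm a%:C%C = `|a|.
Proof. by rewrite /= expr0n addr0 sqrtr_sqr. Qed.

Lemma normcE_norm (z : C) : `|z| = (nrm z)%:C%C.
Proof. by case: z. Qed.

Lemma normc_sqr_conj (z : C) : (nrm z ^+ 2)%:C%C = z * z^*.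
Proof. by rewrite -normCK normcE_norm rmorphXn. Qed.

Lemma normcB_sym (z w : C) : nrm (z - w) = nrm (w - z).
Proof. by rewrite -normcN opprB. Qed.

(** Reduces the extended-real sum to finite sums, on which the norm estimates below are made. *)
Lemma sqnorm_leP (f : X -> C) (M : R) :
  (sqnorm f <= M%:E)%E <-> forall J, \sum_(x <- J) nrm (f x) ^+ 2 <= M.
Proof.
split=> [h J|h].
  rewrite -lee_fin; apply: le_trans h.
  rewrite -sumEFin; apply: esum_ge; exists [set` J].
    by split=> //; exact: finite_fset.
  by rewrite fsbig_finite //= set_fsetK.
apply: ge_ereal_sup => _ [F [finF _] <-].
by rewrite fsbig_finite //= sumEFin lee_fin.
Qed.

Lemma sum_bounded_square_summable (f : X -> C) (M : R) :
  (forall J, \sum_(x <- J) nrm (f x) ^+ 2 <= M) -> f \in @square_summable R X.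
Proof.
by move=> /sqnorm_leP h; apply/asboolP; apply: (le_lt_trans h); rewrite ltry.
Qed.

Lemma sqnorm_ge0 (f : X -> C) : (0 <= sqnorm f)%E.
Proof. by apply: esum_ge0 => x _; rewrite lee_fin sqr_ge0. Qed.

Lemma ell2_norm_ge0 xi : 0 <= ell2_norm xi.
Proof. exact: sqrtr_ge0. Qed.
Hint Resolve ell2_norm_ge0 : core.

Lemma sqnormE xi : sqnorm xi = (ell2_norm xi ^+ 2)%:E.
Proof.
have h : (sqnorm xi < +oo)%E by exact/asboolP/(valP xi).
rewrite /ell2_norm sqr_sqrtr ?fineK ?fine_ge0 ?sqnorm_ge0 //.
by rewrite ge0_fin_numE ?sqnorm_ge0.
Qed.

Lemma sum_le_ell2_norm xi J :
  \sum_(x <- J) nrm (xi x) ^+ 2 <= ell2_norm xi ^+ 2.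
Proof. by move: J; apply/sqnorm_leP; rewrite sqnormE. Qed.

Lemma ell2_norm_le xi (M : R) : 0 <= M ->
  (forall J, \sum_(x <- J) nrm (xi x) ^+ 2 <= M ^+ 2) -> ell2_norm xi <= M.
Proof.
move=> M0 /sqnorm_leP; rewrite sqnormE lee_fin.
by rewrite ler_pXn2r // nnegrE.
Qed.

Lemma normc_le_ell2_norm xi x : nrm (xi x) <= ell2_norm xi.
Proof.
have := sum_le_ell2_norm xi [fset x]%fset.
by rewrite big_seq_fset1 ler_pXn2r // nnegrE ?normc_ge0.
Qed.

Lemma ell2P xi eta : (forall x, xi x = eta x) -> xi = eta.
Proof. by move=> h; apply: val_inj; apply/funext. Qed.

Lemma ell2D xi eta x : (xi + eta) x = xi x + eta x.
Proof. by []. Qed.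

Lemma ell2N xi x : (- xi) x = - xi x.
Proof. by []. Qed.

Lemma ell2B xi eta x : (xi - eta) x = xi x - eta x.
Proof. by []. Qed.

Lemma ell2Z (c : C) xi x : (c *: xi) x = c * xi x.
Proof. by []. Qed.

Lemma ell20 x : (0 : L2) x = 0.
Proof. by []. Qed.

Lemma ell2_norm0_eq0 xi : ell2_norm xi = 0 -> xi = 0.
Proof.
move=> h; apply: ell2P => x; apply/ComplexField.Normc.eq0_normc/le_anti.
by rewrite normc_ge0 andbT -h normc_le_ell2_norm.
Qed.

Lemma ell2_norm0 : ell2_norm (0 : L2) = 0.
Proof.
apply: le_anti; rewrite ell2_norm_ge0 andbT; apply: ell2_norm_le => // J.
by rewrite big1 ?expr0n // => x _; rewrite ell20 ComplexField.Normc.normc0 expr0n.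
Qed.

Lemma ell2_normZ (c : C) xi : ell2_norm (c *: xi) = nrm c * ell2_norm xi.
Proof.
have le (d : C) eta : ell2_norm (d *: eta) <= nrm d * ell2_norm eta.
  apply: ell2_norm_le => [|J]; first by rewrite mulr_ge0 ?normc_ge0.
  under eq_bigr do rewrite ell2Z ComplexField.Normc.normcM exprMn.
  by rewrite -mulr_sumr exprMn ler_wpM2l ?sqr_ge0 ?sum_le_ell2_norm.
apply: le_anti; rewrite le /=.
have [->|c0] := eqVneq c 0.
  by rewrite ComplexField.Normc.normc0 mul0r ell2_norm_ge0.
have n0 : 0 < nrm c.
  rewrite lt_def normc_ge0 andbT; apply: contra_neq c0.
  exact: ComplexField.Normc.eq0_normc.
rewrite -ler_pdivlMl //; have := le c^-1 (c *: xi).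
by rewrite scalerA mulVf // scale1r ComplexField.Normc.normcV.
Qed.

Lemma ell2_normN xi : ell2_norm (- xi) = ell2_norm xi.
Proof.
by rewrite -scaleN1r ell2_normZ normcN ComplexField.Normc.normc1 mul1r.
Qed.

(** Once |a + b| is replaced by |a| + |b|, the two sides differ by the square t^-1 (t |a| - |b|)^2.
    Summed with t = |eta| / |xi|, the bound becomes (|xi| + |eta|)^2, whence the triangle
    inequality. *)
Lemma normcD_sqr_weighted (a b : C) (t : R) : 0 < t ->
  nrm (a + b) ^+ 2 <= (1 + t) * nrm a ^+ 2 + (1 + t^-1) * nrm b ^+ 2.
Proof.
move=> t0; apply: (@le_trans _ _ ((nrm a + nrm b) ^+ 2)).
  by rewrite ler_pXn2r ?nnegrE ?addr_ge0 ?normc_ge0 // le_normcD.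
rewrite -subr_ge0.
rewrite (_ : _ - _ = t^-1 * (t * nrm a - nrm b) ^+ 2); last first.
  by field; rewrite gt_eqF.
by rewrite mulr_ge0 ?sqr_ge0 // invr_ge0 ltW.
Qed.

Lemma ell2_normD xi eta : ell2_norm (xi + eta) <= ell2_norm xi + ell2_norm eta.
Proof.
apply/ler_addgt0Pr => e e0.
(* The slack keeps both numbers positive, so that the weight [b / a] makes sense even when a vector
   vanishes. *)
set a := ell2_norm xi + e / 2; set b := ell2_norm eta + e / 2.
have h2 : 0 < e / 2 by rewrite divr_gt0.
have a0 : 0 < a by rewrite ltr_wpDl.
have b0 : 0 < b by rewrite ltr_wpDl.
have -> : ell2_norm xi + ell2_norm eta + e = a + b by rewrite /a /b; field.
apply: ell2_norm_le => [|J]; first by rewrite addr_ge0 ?ltW.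
have t0 : 0 < b / a by rewrite divr_gt0.
apply: (@le_trans _ _ ((1 + b / a) * a ^+ 2 + (1 + (b / a)^-1) * b ^+ 2)).
  apply: (@le_trans _ _ (\sum_(x <- J) ((1 + b / a) * nrm (xi x) ^+ 2 +
      (1 + (b / a)^-1) * nrm (eta x) ^+ 2))).
    by apply: ler_sum => x _; apply: normcD_sqr_weighted.
  rewrite big_split /= -!mulr_sumr; apply: lerD; rewrite ler_wpM2l //.
  - by rewrite addr_ge0 // ltW.
  - apply: (le_trans (sum_le_ell2_norm _ _)).
    rewrite ler_pXn2r ?nnegrE //; first by rewrite lerDl ltW.
    exact: ltW.
  - by rewrite addr_ge0 // invr_ge0 ltW.
  - apply: (le_trans (sum_le_ell2_norm _ _)).
    rewrite ler_pXn2r ?nnegrE //; first by rewrite lerDl ltW.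
    exact: ltW.
rewrite le_eqVlt; apply/orP; left; apply/eqP; field.
by rewrite !gt_eqF.
Qed.

Lemma ell2_normB xi eta : ell2_norm (xi - eta) <= ell2_norm xi + ell2_norm eta.
Proof. by rewrite -(ell2_normN eta); apply: ell2_normD. Qed.

End Ell2Norm.

(** * Convergence of the inner product *)

Section Ell2Dot.
Import showcase.summability.
Variables (R : realType) (X : choiceType).
Local Notation C := R[i].
Local Notation nrm := (@ComplexField.Normc.normc R).
Local Notation L2 := (ell2 R X).
Implicit Types (xi eta : L2) (J : {fset X}).

(** [ell2_dot] is defined as a limit, which says nothing until convergence is known. This predicate
    carries convergence together with the value, with real tolerances. *)
Definition is_sum (u : X -> C) (l : C) : Prop :=
  forall e : R, 0 < e -> exists J0 : {fset X}, forall J : {fset X},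
    (J0 `<=` J)%fset -> nrm (\sum_(x <- J) u x - l) < e.

Lemma gt0_complex (e : C) : 0 < e -> e = (complex.Re e)%:C%C /\ 0 < complex.Re e.
Proof. by case: e => a b; rewrite ltcE /= => /andP[/eqP -> ?]. Qed.

Lemma is_sum_sum (u : X -> C) (l : C) : is_sum u l ->
  sum (R := R[i]^o) u = l.
Proof.
move=> h; apply: cvg_lim; [exact: norm_hausdorff|exact: totally_filter|].
have FT := @totally_filter X.
apply/cvgrPdist_lt => e /gt0_complex [-> e0].
have [J0 hJ0] := h _ e0; exists J0 => // J /= J0J.
rewrite normcE_norm ltcR normcB_sym; move: (hJ0 J J0J).
by rewrite /partial_sum big_seq_fsetE.
Qed.

Lemma is_sum_unique u l l' : is_sum u l -> is_sum u l' -> l = l'.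
Proof. by move=> /is_sum_sum <- /is_sum_sum <-. Qed.

Lemma is_sumD u v l m : is_sum u l -> is_sum v m -> is_sum (u \+ v) (l + m).
Proof.
move=> hu hv e e0; have e2 : 0 < e / 2 by rewrite divr_gt0.
have [J0 h0] := hu _ e2; have [J1 h1] := hv _ e2.
exists (J0 `|` J1)%fset => J; rewrite fsubUset => /andP[/h0 a0 /h1 a1].
rewrite big_split /= opprD addrACA; apply: (le_lt_trans (le_normcD _ _)).
by rewrite (splitr e) ltrD.
Qed.

Lemma is_sumZ (c : C) u l : is_sum u l -> is_sum (fun x => c * u x) (c * l).
Proof.
move=> hu e e0; have c0 : 0 < nrm c + 1 by rewrite ltr_pwDr // normc_ge0.
have [J0 h0] := hu _ (divr_gt0 e0 c0); exists J0 => J /h0 h.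
rewrite -mulr_sumr -mulrBr ComplexField.Normc.normcM.
apply: (@le_lt_trans _ _ ((nrm c + 1) * nrm (\sum_(x <- J) u x - l))).
  by rewrite ler_wpM2r ?normc_ge0 // lerDl.
by rewrite -ltr_pdivlMl // mulrC.
Qed.

Lemma normc_conj (z : C) : nrm z^* = nrm z.
Proof. by case: z => a b; rewrite /= sqrrN. Qed.

Lemma is_sum_conj u l : is_sum u l -> is_sum (fun x => (u x)^*) l^*.
Proof.
move=> hu e /hu [J0 h0]; exists J0 => J /h0.
by rewrite -rmorph_sum -rmorphB normc_conj.
Qed.

Lemma eq_is_sum u v l : u =1 v -> is_sum u l -> is_sum v l.
Proof. by move=> /funext ->. Qed.

Lemma is_sum_norm xi : is_sum (fun x => xi x * (xi x)^*) (ell2_norm xi ^+ 2)%:C%C.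
Proof.
move=> e e0.
have [J0 hJ0] : exists J0 : {fset X},
    ell2_norm xi ^+ 2 - e < \sum_(x <- J0) nrm (xi x) ^+ 2.
  apply: contrapT => /forallNP h.
  have : (sqnorm xi <= (ell2_norm xi ^+ 2 - e)%:E)%E.
    by apply/sqnorm_leP => J; rewrite leNgt; apply/negP; exact: h.
  by rewrite sqnormE lee_fin lerBrDr gerDl leNgt e0.
exists J0 => J J0J.
under eq_bigr do rewrite -normc_sqr_conj.
rewrite -rmorph_sum -rmorphB normc_complex distrC ger0_norm.
  rewrite ltrBlDl -ltrBlDr; apply: (lt_le_trans hJ0).
  rewrite (big_fsetID _ (mem J0) J) /=.
  rewrite (_ : [fset x in J | x \in J0]%fset = J0).
    by rewrite lerDl; apply: sumr_ge0 => x _; rewrite sqr_ge0.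
  apply/fsetP => x; rewrite !inE /=; apply/andP/idP => [[]//|xJ]; split=> //.
  exact: (fsubsetP J0J).
by rewrite subr_ge0 sum_le_ell2_norm.
Qed.

Lemma is_sum_dot xi eta :
  is_sum (fun x => xi x * (eta x)^*) (ell2_dot xi eta).
Proof.
suff [l hl] : exists l, is_sum (fun x => xi x * (eta x)^*) l.
  by rewrite /ell2_dot (is_sum_sum hl).
(* polarization reduces convergence to that of the norms *)
pose N (zeta : L2) := (ell2_norm zeta ^+ 2)%:C%C.
exists (4^-1 * (N (xi + eta) + (-1) * N (xi - eta) + 'i * N (xi + 'i *: eta)
     + (- 'i) * N (xi - 'i *: eta))).
apply: eq_is_sum; last first.
  apply: is_sumZ; apply: is_sumD; last by apply: is_sumZ; exact: is_sum_norm.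
  apply: is_sumD; last by apply: is_sumZ; exact: is_sum_norm.
  apply: is_sumD; last by apply: is_sumZ; exact: is_sum_norm.
  exact: is_sum_norm.
move=> x; cbv beta delta [GRing.add_fun] iota; rewrite !(ell2D, ell2B, ell2N, ell2Z).
rewrite !(rmorphD, rmorphB, rmorphN, rmorphM) /= conjCi.
set a := xi x; set b := eta x; set a' := a^*; set b' := b^*.
have i2 : 'i * 'i = -1 :> C by rewrite -expr2 sqrCi.
have -> : a * b' = 4^-1 * (4 * (a * b')) by rewrite mulKf // pnatr_eq0.
congr (_ * _).
transitivity ((a + b) * (a' + b') + -1 * ((a - b) * (a' - b')) +
   ('i * (a * a') - ('i * 'i) * (a * b') + ('i * 'i) * (b * a') - 'i * ('i * 'i) * (b * b')) +
   (- 'i * (a * a') - ('i * 'i) * (a * b') + ('i * 'i) * (b * a') + 'i * ('i * 'i) * (b * b'))).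
  by ring.
rewrite i2; ring.
Qed.
End Ell2Dot.

(** * Sesquilinearity, the Cauchy-Schwarz inequality and adjoints *)

Section Adjoint.
Variables (R : realType) (X : choiceType).
Local Notation C := R[i].
Local Notation nrm := (@ComplexField.Normc.normc R).
Local Notation L2 := (ell2 R X).
Implicit Types (xi eta zeta : L2) (J : {fset X}) (S T U : L2 -> L2).

Lemma conjC_real (a : R) : (a%:C%C : C)^* = a%:C%C.
Proof. exact: conjc_real. Qed.

Lemma ell2_dotDl xi eta zeta :
  ell2_dot (xi + eta) zeta = ell2_dot xi zeta + ell2_dot eta zeta.
Proof.
apply: (is_sum_unique (is_sum_dot _ _)).
apply: eq_is_sum (is_sumD (is_sum_dot xi zeta) (is_sum_dot eta zeta)) => x.
by rewrite ell2D mulrDl.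
Qed.

Lemma ell2_dotZl (c : C) xi zeta :
  ell2_dot (c *: xi) zeta = c * ell2_dot xi zeta.
Proof.
apply: (is_sum_unique (is_sum_dot _ _)).
apply: eq_is_sum (is_sumZ c (is_sum_dot xi zeta)) => x.
by rewrite ell2Z mulrA.
Qed.

Lemma ell2_dot_conj xi eta : (ell2_dot xi eta)^* = ell2_dot eta xi.
Proof.
apply: is_sum_unique (is_sum_dot eta xi).
apply: eq_is_sum (is_sum_conj (is_sum_dot xi eta)) => x.
by rewrite rmorphM /= conjCK mulrC.
Qed.

Lemma ell2_dotDr xi eta zeta :
  ell2_dot zeta (xi + eta) = ell2_dot zeta xi + ell2_dot zeta eta.
Proof.
by rewrite -![ell2_dot zeta _]ell2_dot_conj ell2_dotDl rmorphD.
Qed.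

Lemma ell2_dotZr (c : C) xi zeta :
  ell2_dot zeta (c *: xi) = c^* * ell2_dot zeta xi.
Proof. by rewrite -![ell2_dot zeta _]ell2_dot_conj ell2_dotZl rmorphM. Qed.

Lemma ell2_dotNl xi zeta : ell2_dot (- xi) zeta = - ell2_dot xi zeta.
Proof. by rewrite -scaleN1r ell2_dotZl mulN1r. Qed.

Lemma ell2_dotNr xi zeta : ell2_dot zeta (- xi) = - ell2_dot zeta xi.
Proof. by rewrite -![ell2_dot zeta _]ell2_dot_conj ell2_dotNl rmorphN. Qed.

Lemma ell2_dotxx xi : ell2_dot xi xi = (ell2_norm xi ^+ 2)%:C%C.
Proof. exact: is_sum_unique (is_sum_dot _ _) (is_sum_norm _). Qed.

Lemma ell2_cauchy_schwarz xi eta :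
  nrm (ell2_dot xi eta) <= ell2_norm xi * ell2_norm eta.
Proof.
have [/ell2_norm0_eq0 ->|n0] := eqVneq (ell2_norm eta) 0.
  rewrite -(scale0r (0 : L2)) ell2_dotZr conjC0 mul0r.
  by rewrite ComplexField.Normc.normc0 mulr_ge0 ?ell2_norm_ge0.
set a := ell2_dot xi eta; set n := ell2_norm eta.
have np : 0 < n by rewrite lt_def n0 ell2_norm_ge0.
(* The coefficient of the projection of [xi] onto [eta]; the inequality says that the remainder has
   non-negative squared norm. *)
pose c : C := a / (n ^+ 2)%:C%C.
have nC : (n ^+ 2)%:C%C != 0 :> C by rewrite eq_complex /= eqxx andbT sqrf_eq0.
have cJ : c^* = a^* / (n ^+ 2)%:C%C.
  by rewrite /c rmorphM fmorphV; congr (_ / _); exact: conjC_real.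
have : ell2_dot (xi - c *: eta) (xi - c *: eta) =
    (ell2_norm xi ^+ 2 - nrm a ^+ 2 / n ^+ 2)%:C%C.
  rewrite ell2_dotDl !ell2_dotDr !ell2_dotNl !ell2_dotNr !ell2_dotZl !ell2_dotZr.
  rewrite -(ell2_dot_conj xi eta) -/a !ell2_dotxx -/n cJ.
  have realE (x y z : R) : (x - y / z)%:C%C = x%:C%C - y%:C%C / z%:C%C :> C.
    by rewrite rmorphB rmorphM fmorphV.
  rewrite realE normc_sqr_conj /c.
  set N := (n ^+ 2)%:C%C in nC *; set M := (ell2_norm xi ^+ 2)%:C%C.
  have aux (x y K L : C) : K != 0 ->
      L - y / K * x + (- (x / K * y) - - (x / K * (y / K * K))) = L - x * y / K.
    by move=> K0; field.
  exact: aux.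
rewrite ell2_dotxx => /complexI h.
have : 0 <= ell2_norm xi ^+ 2 - nrm a ^+ 2 / n ^+ 2 by rewrite -h sqr_ge0.
rewrite subr_ge0 ler_pdivrMr ?exprn_gt0 // -exprMn.
by rewrite ler_pXn2r ?nnegrE ?normc_ge0 ?mulr_ge0 ?ell2_norm_ge0.
Qed.

Lemma is_adjoint_sym S T : is_adjoint S T -> is_adjoint T S.
Proof. by move=> h xi eta; rewrite -ell2_dot_conj -h ell2_dot_conj. Qed.

Lemma is_adjoint0 : is_adjoint (0 : L2 -> L2) 0.
Proof.
move=> xi eta; rewrite -[LHS]/(ell2_dot 0 eta) -[RHS]/(ell2_dot xi 0).
by rewrite -(scale0r (0 : L2)) ell2_dotZl ell2_dotZr conjC0 !mul0r.
Qed.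

Lemma is_adjoint_comp S S' T T' : is_adjoint S S' -> is_adjoint T T' ->
  is_adjoint (S \o T) (T' \o S').
Proof. by move=> hS hT xi eta /=; rewrite hS hT. Qed.

Lemma is_adjointD S S' T T' : is_adjoint S S' -> is_adjoint T T' ->
  is_adjoint (S + T) (S' + T').
Proof. by move=> hS hT xi eta; rewrite ell2_dotDl ell2_dotDr hS hT. Qed.

Lemma is_adjointN S S' : is_adjoint S S' -> is_adjoint (- S) (- S').
Proof. by move=> hS xi eta; rewrite ell2_dotNl ell2_dotNr hS. Qed.

Lemma is_adjointZ (a : R) S S' : is_adjoint S S' ->
  is_adjoint (a%:C%C *: S) (a%:C%C *: S').
Proof.
by move=> hS xi eta; rewrite ell2_dotZl ell2_dotZr hS conjC_real.
Qed.

End Adjoint.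

(** * Bounded operators *)

Section Operators.
Variables (R : realType) (X : choiceType).
Local Notation C := R[i].
Local Notation nrm := (@ComplexField.Normc.normc R).
Local Notation L2 := (ell2 R X).
Implicit Types (xi eta zeta : L2) (S T U : L2 -> L2) (A : set (L2 -> L2)).

(** Estimates carry an explicit bound instead of [opnorm], an infimum that is informative only once
    some bound exists; [norm_closureP] makes the passage. *)
Definition op_le T (M : R) : Prop :=
  0 <= M /\ forall xi, ell2_norm (T xi) <= M * ell2_norm xi.

Lemma op_le_weaken T M N : op_le T M -> M <= N -> op_le T N.
Proof.
move=> [M0 h] MN; split=> [|xi]; first exact: le_trans M0 MN.
by apply: (le_trans (h xi)); rewrite ler_wpM2r ?ell2_norm_ge0.
Qed.

Lemma op_leD S T M N : op_le S M -> op_le T N -> op_le (S + T) (M + N).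
Proof.
move=> [M0 hM] [N0 hN]; split=> [|xi]; first exact: addr_ge0.
by apply: (le_trans (ell2_normD _ _)); rewrite mulrDl lerD.
Qed.

Lemma op_leN S M : op_le S M -> op_le (- S) M.
Proof. by move=> [M0 hM]; split=> // xi; rewrite ell2_normN. Qed.

Lemma op_leB S T M N : op_le S M -> op_le T N -> op_le (S - T) (M + N).
Proof. by move=> hS /op_leN; apply: op_leD. Qed.

Lemma op_le_sym S T M : op_le (S - T) M -> op_le (T - S) M.
Proof. by move=> /op_leN; rewrite opprB. Qed.

Lemma op_le_comp S T M N : op_le S M -> op_le T N -> op_le (S \o T) (M * N).
Proof.
move=> [M0 hM] [N0 hN]; split=> [|xi]; first exact: mulr_ge0.
by apply: (le_trans (hM _)); rewrite -mulrA ler_wpM2l.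
Qed.

Lemma op_leZ (c : C) S M : op_le S M -> op_le (c *: S) (nrm c * M).
Proof.
move=> [M0 hM]; split=> [|xi]; first by rewrite mulr_ge0 ?normc_ge0.
by rewrite ell2_normZ -mulrA ler_wpM2l ?normc_ge0.
Qed.

Lemma op_le_id : op_le (id : L2 -> L2) 1.
Proof. by split=> // xi; rewrite mul1r. Qed.

Lemma op_le0 : op_le (0 : L2 -> L2) 0.
Proof. by split=> // xi; rewrite mul0r ell2_norm0. Qed.

Lemma op_le_small_eq0 T : (forall e, 0 < e -> op_le T e) -> T = 0.
Proof.
move=> h; apply/funext => xi; apply: ell2_norm0_eq0; apply: le_anti.
rewrite ell2_norm_ge0 andbT; apply/ler_addgt0Pr => e e0; rewrite add0r.
have n1 : 0 < ell2_norm xi + 1 by rewrite ltr_pwDr // ell2_norm_ge0.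
have [_ /(_ xi) h1] := h _ (divr_gt0 e0 n1); apply: (le_trans h1).
by rewrite -mulrA ger_pMr // mulrC ler_pdivrMr // mul1r lerDl.
Qed.

Lemma bounded_opP T : bounded_op T <-> linear T /\ exists M, op_le T M.
Proof.
split=> [[lT [M hM]]|[lT [M [M0 hM]]]]; last by split=> //; exists M.
split=> //; exists `|M|; split=> // xi; apply: (le_trans (hM xi)).
by rewrite ler_wpM2r ?ell2_norm_ge0 // ler_norm.
Qed.

Lemma bounded_op_bound T : bounded_op T -> exists M, op_le T M.
Proof. by move=> /bounded_opP []. Qed.

Lemma bounded_op_linear T : bounded_op T -> linear T.
Proof. by case. Qed.

Lemma bounded_opD S T : bounded_op S -> bounded_op T -> bounded_op (S + T).
Proof.
move=> /bounded_opP [lS [M hM]] /bounded_opP [lT [N hN]]; apply/bounded_opP.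
split; last by exists (M + N); exact: op_leD.
move=> a u v; rewrite -[LHS]/(S (a *: u + v) + T (a *: u + v)) lS lT.
by rewrite scalerDr addrACA.
Qed.

Lemma bounded_opZ (c : C) S : bounded_op S -> bounded_op (c *: S).
Proof.
move=> /bounded_opP [lS [M hM]]; apply/bounded_opP.
split; last by exists (nrm c * M); exact: op_leZ.
move=> a u v; rewrite -[LHS]/(c *: S (a *: u + v)) lS.
by rewrite scalerDr !scalerA mulrC.
Qed.

Lemma bounded_opN S : bounded_op S -> bounded_op (- S).
Proof. by rewrite -scaleN1r; apply: bounded_opZ. Qed.

Lemma bounded_opB S T : bounded_op S -> bounded_op T -> bounded_op (S - T).
Proof. by move=> hS /bounded_opN; apply: bounded_opD. Qed.

Lemma bounded_op_comp S T : bounded_op S -> bounded_op T -> bounded_op (S \o T).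
Proof.
move=> /bounded_opP [lS [M hM]] /bounded_opP [lT [N hN]]; apply/bounded_opP.
split; last by exists (M * N); exact: op_le_comp.
by move=> a u v /=; rewrite lT lS.
Qed.

Lemma bounded_op_id : bounded_op (id : L2 -> L2).
Proof. by apply/bounded_opP; split=> //; exists 1; exact: op_le_id. Qed.

Lemma bounded_op0 : bounded_op (0 : L2 -> L2).
Proof. by rewrite -(scale0r (id : L2 -> L2)); exact: bounded_opZ bounded_op_id. Qed.

(* [opnorm] is 0, as the infimum of the empty set, on unbounded operators: hence
   the assumption on [A]. *)
Lemma norm_closureP A T : A `<=` @bounded_op R X ->
  norm_closure A T <->
  bounded_op T /\ forall e, 0 < e -> exists2 S, A S & op_le (T - S) e.
Proof.
move=> bA; split=> [[bT h]|[bT h]]; split=> // e e0.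
  have [S [AS lte]] := h e e0; exists S => //.
  have [M hM] := bounded_op_bound (bounded_opB bT (bA _ AS)).
  have hi : has_inf [set M | op_le (T - S) M].
    by split; [exists M|exists 0 => x []].
  have [N hN Ne] : exists2 N, op_le (T - S) N & N < e.
    exact: (inf_lt hi.1 lte).
  exact: op_le_weaken hN (ltW Ne).
have e2 : 0 < e / 2 by rewrite divr_gt0.
have [S AS hS] := h _ e2; exists S; split=> //.
apply: (@le_lt_trans _ _ (e / 2)); last by rewrite ltr_pdivrMr // ltr_pMr // ltr1n.
by apply: ge_inf => //; exists 0 => x [].
Qed.

End Operators.

(** * Completeness of l^2 and of its bounded operators *)

Section Completeness.
Variables (R : realType) (X : choiceType).
Local Notation C := R[i].
Local Notation nrm := (@ComplexField.Normc.normc R).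
Local Notation L2 := (ell2 R X).
Implicit Types (xi eta zeta : L2) (S T U : L2 -> L2) (A : set (L2 -> L2)).

Lemma half_expn_small (K e : R) : 0 < e -> exists n : nat, K * 2^-1 ^+ n < e.
Proof.
move=> e0; have Kp : 0 <= `|K| / e by rewrite divr_ge0 // ltW.
have := archi_boundP Kp; set n := Num.bound _ => hn.
exists n; rewrite exprVn ltr_pdivrMr ?exprn_gt0 //.
apply: (le_lt_trans (ler_norm K)); rewrite mulrC -ltr_pdivrMr //.
apply: (lt_trans hn); rewrite -natrX ltr_nat; exact: ltn_expl.
Qed.

Lemma ler_addgt0_half_expn (a b K : R) :
  (forall n : nat, a <= b + K * 2^-1 ^+ n) -> a <= b.
Proof.
move=> h; apply/ler_addgt0Pr => e e0.
have [n hn] := half_expn_small K e0.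
by apply: (le_trans (h n)); rewrite lerD2l ltW.
Qed.

(** Stated for any subadditive [N] so that it serves both real numbers and vectors of l^2. *)
Lemma geometric_dist (V : zmodType) (N : V -> R) (s : nat -> V) (c : R) :
    0 <= c -> N 0 = 0 -> (forall v w, N (v + w) <= N v + N w) ->
    (forall n, N (s n.+1 - s n) <= c * 2^-1 ^+ n) ->
  forall n m, N (s (n + m)%N - s n) <= 2 * c * 2^-1 ^+ n.
Proof.
move=> c0 N0 ND h n m.
(* The subtracted term makes the induction on [m] close: it shrinks by exactly c / 2^(n + m) at each
   step. *)
suff : N (s (n + m)%N - s n) <= 2 * c * 2^-1 ^+ n - 2 * c * 2^-1 ^+ (n + m)%N.
  move=> /le_trans; apply; rewrite gerBl.
  by rewrite !mulr_ge0 // exprn_ge0.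
elim: m => [|m IH]; first by rewrite addn0 !subrr N0.
rewrite addnS (_ : _ - _ = (s (n + m).+1 - s (n + m)%N) + (s (n + m)%N - s n));
  last by rewrite addrA subrK.
apply: (le_trans (ND _ _)); apply: (le_trans (lerD (h _) IH)).
by rewrite [2^-1 ^+ (n + m).+1]exprS; lra.
Qed.

Lemma real_geometric_limit (a : nat -> R) (c : R) : 0 <= c ->
    (forall n, `|a n.+1 - a n| <= c * 2^-1 ^+ n) ->
  exists l, forall n, `|l - a n| <= 2 * c * 2^-1 ^+ n.
Proof.
move=> c0 h.
have hd := geometric_dist c0 (@normr0 _ _) (@ler_normD _ _) h.
(* Nested intervals: the limit is the supremum of the left ends, every right end being an upper
   bound. *)
pose E := [set a n - 2 * c * 2^-1 ^+ n | n in [set: nat]].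
have ubE n : ubound E (a n + 2 * c * 2^-1 ^+ n).
  move=> _ [m _ <-]; have k0 k : 0 <= 2 * c * 2^-1 ^+ k.
    by rewrite !mulr_ge0 // exprn_ge0.
  case: (leqP n m) => nm.
    have := hd n (m - n)%N; rewrite subnKC // ler_norml => /andP[_].
    by have := k0 m; lra.
  have := hd m (n - m)%N; rewrite (subnKC (ltnW nm)) ler_norml => /andP[+ _].
  by have := k0 n; lra.
have hE : has_sup E.
  split; first by exists (a 0 - 2 * c * 2^-1 ^+ 0), 0.
  by exists (a 0 + 2 * c * 2^-1 ^+ 0).
exists (sup E) => n.
have h1 : a n - 2 * c * 2^-1 ^+ n <= sup E.
  by apply: sup_upper_bound => //; exists n.
have h2 : sup E <= a n + 2 * c * 2^-1 ^+ n.
  by apply: ge_sup => //; exact: hE.1.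
by rewrite ler_norml; apply/andP; split; lra.
Qed.

Lemma normc_ge_ReIm (z : C) :
  `|complex.Re z| <= nrm z /\ `|complex.Im z| <= nrm z.
Proof.
case: z => a b /=; split; rewrite -sqrtr_sqr ler_wsqrtr //.
  by rewrite lerDl sqr_ge0.
by rewrite lerDr sqr_ge0.
Qed.

Lemma normc_le_ReIm (z : C) : nrm z <= `|complex.Re z| + `|complex.Im z|.
Proof.
case: z => a b /=; rewrite -[leRHS]ger0_norm ?addr_ge0 // -sqrtr_sqr.
rewrite ler_wsqrtr // sqrrD !real_normK ?num_real // addrAC lerDl.
by rewrite mulrn_wge0 // mulr_ge0.
Qed.

Lemma complex_geometric_limit (a : nat -> C) (c : R) : 0 <= c ->
    (forall n, nrm (a n.+1 - a n) <= c * 2^-1 ^+ n) ->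
  exists l, forall n, nrm (l - a n) <= 4 * c * 2^-1 ^+ n.
Proof.
move=> c0 h.
have ReB (u v : C) : complex.Re (u - v) = complex.Re u - complex.Re v.
  by case: u v => [? ?] [? ?].
have ImB (u v : C) : complex.Im (u - v) = complex.Im u - complex.Im v.
  by case: u v => [? ?] [? ?].
have [||x hx] := @real_geometric_limit (fun n => complex.Re (a n)) c; rewrite //.
  by move=> n; rewrite -ReB; exact: le_trans (normc_ge_ReIm _).1 (h n).
have [||y hy] := @real_geometric_limit (fun n => complex.Im (a n)) c; rewrite //.
  by move=> n; rewrite -ImB; exact: le_trans (normc_ge_ReIm _).2 (h n).
exists (Complex x y) => n; apply: (le_trans (normc_le_ReIm _)).
by rewrite ReB ImB /=; move: (hx n) (hy n); lra.
Qed.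

Lemma ell2_geometric_limit (s : nat -> L2) (c : R) : 0 <= c ->
    (forall n, ell2_norm (s n.+1 - s n) <= c * 2^-1 ^+ n) ->
  exists l, forall n, ell2_norm (l - s n) <= 4 * c * 2^-1 ^+ n.
Proof.
move=> c0 h.
have k0 n : 0 <= c * 2^-1 ^+ n by rewrite mulr_ge0 // exprn_ge0.
have hd := geometric_dist c0 (ell2_norm0 _ _) (@ell2_normD _ _) h.
have /choice [f hf] x : exists l, forall n, nrm (l - s n x) <= 4 * c * 2^-1 ^+ n.
  apply: complex_geometric_limit => // n; rewrite -ell2N -ell2D.
  exact: le_trans (normc_le_ell2_norm _ _) (h n).
have sumf n (J : {fset X}) :
    \sum_(x <- J) nrm (f x - s n x) ^+ 2 <= (4 * c * 2^-1 ^+ n) ^+ 2.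
  set D := 2 * c * 2^-1 ^+ n.
  apply: (@le_trans _ _ (2 * D ^+ 2)); last first.
    by rewrite /D !exprMn; have := sqr_ge0 (c * 2^-1 ^+ n); rewrite exprMn; lra.
  (* Compare with [s (n + k)]: on the fixed finite set [J] its distance to [f] tends to 0 as [k]
     grows, while its distance to [s n] stays below [D]. The factor 2 of [normcD_sqr] is absorbed in
     passing from [2 * c] to [4 * c]. *)
  apply: (@ler_addgt0_half_expn _ _ (2 * (4 * c) ^+ 2 * (size J)%:R)) => k.
  apply: (@le_trans _ _ (\sum_(x <- J) (2 * (4 * c * 2^-1 ^+ (n + k)) ^+ 2 +
      2 * nrm ((s (n + k)%N - s n) x) ^+ 2))).
    apply: ler_sum => x _.
    rewrite (_ : f x - s n x = (f x - s (n + k)%N x) + (s (n + k)%N - s n) x);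
      last by rewrite ell2D ell2N addrA subrK.
    apply: (le_trans (normcD_sqr _ _)); rewrite lerD2r ler_pM2l //.
    by rewrite ler_pXn2r ?nnegrE ?normc_ge0 // -mulrA mulr_ge0.
  rewrite big_split /= addrC lerD //.
    rewrite -mulr_sumr ler_pM2l //.
    apply: (le_trans (sum_le_ell2_norm (s (n + k)%N - s n) J)).
    rewrite ler_pXn2r ?nnegrE ?ell2_norm_ge0 //.
    by rewrite /D -mulrA mulr_ge0.
  rewrite big_const_seq count_predT iter_addr_0 -[leLHS]mulr_natr exprD.
  have e1 m : 0 <= (2^-1 : R) ^+ m <= 1.
    by rewrite exprn_ge0 //= exprn_ile1 // invf_le1 // ler1n.
  set p := 2^-1 ^+ n; set q := 2^-1 ^+ k; set N := (size J)%:R.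
  have /andP[p0 p1] := e1 n; have /andP[q0 q1] := e1 k.
  have N0 : 0 <= N by rewrite /N ler0n.
  rewrite [leLHS](_ : _ = 2 * (4 * c) ^+ 2 * N * (p ^+ 2 * q ^+ 2)); last by rewrite /p /q; ring.
  rewrite ler_wpM2l ?mulr_ge0 ?sqr_ge0 //.
  rewrite -[leRHS]mul1r ler_pM ?sqr_ge0 //; first by rewrite exprn_ile1.
  by rewrite expr2 ger_pMr // lt_def q0 andbT expf_neq0 // invr_eq0 pnatr_eq0.
pose d : X -> C := fun x => f x - s 0 x.
have hdL : d \in @square_summable R X.
  by apply: (@sum_bounded_square_summable _ _ _ ((4 * c * 2^-1 ^+ 0) ^+ 2)) => J; exact: sumf.
exists (Ell2 hdL + s 0) => n; apply: ell2_norm_le => [|J].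
  by rewrite -mulrA mulr_ge0.
under eq_bigr do rewrite ell2D ell2N ell2D /= /d subrK.
exact: sumf.
Qed.

Lemma op_geometric_limit (s : nat -> L2 -> L2) (c : R) :
    (forall n, linear (s n)) -> (exists M, op_le (s 0%N) M) -> 0 <= c ->
    (forall n, op_le (s n.+1 - s n) (c * 2^-1 ^+ n)) ->
  exists2 T, bounded_op T & forall n, op_le (T - s n) (4 * c * 2^-1 ^+ n).
Proof.
move=> ls [M hM] c0 h.
have k0 n : 0 <= c * 2^-1 ^+ n by rewrite mulr_ge0 // exprn_ge0.
have /choice [T hT] xi : exists l, forall n,
    ell2_norm (l - s n xi) <= 4 * (c * ell2_norm xi) * 2^-1 ^+ n.
  apply: ell2_geometric_limit => [|n]; first by rewrite mulr_ge0 ?ell2_norm_ge0.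
  by apply: le_trans ((h n).2 xi) _; rewrite mulrAC.
have hTn n : op_le (T - s n) (4 * c * 2^-1 ^+ n).
  split=> [|xi]; first by rewrite -mulrA mulr_ge0.
  by apply: (le_trans (hT xi n)); rewrite mulrA mulrAC.
exists T => //; apply/bounded_opP; split; last first.
  exists (4 * c * 2^-1 ^+ 0 + M); rewrite -[T](subrK (s 0%N)).
  exact: op_leD.
move=> a u v; apply/eqP; rewrite -subr_eq0; apply/eqP/ell2_norm0_eq0.
apply: le_anti; rewrite ell2_norm_ge0 andbT.
apply: (@ler_addgt0_half_expn _ _ (4 * c * (ell2_norm (a *: u + v) +
   nrm a * ell2_norm u + ell2_norm v))) => n; rewrite add0r.
have -> : T (a *: u + v) - (a *: T u + T v) = (T - s n) (a *: u + v)
    - (a *: (T - s n) u + (T - s n) v).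
  rewrite -[(T - s n) (a *: u + v)]/(T (a *: u + v) - s n (a *: u + v)).
  rewrite -[(T - s n) u]/(T u - s n u) -[(T - s n) v]/(T v - s n v) ls.
  apply: ell2P => x; rewrite !(ell2D, ell2N, ell2Z); ring.
apply: (le_trans (ell2_normB _ _)).
apply: (le_trans (lerD (lexx _) (ell2_normD _ _))).
rewrite ell2_normZ.
have h1 := (hTn n).2 (a *: u + v); have h2 := (hTn n).2 u; have h3 := (hTn n).2 v.
have h4 := ler_wpM2l (normc_ge0 a) h2.
move: h1 h3 h4; set q := 2^-1 ^+ n; move: (ell2_norm _) (ell2_norm _) (ell2_norm _)
  (ell2_norm _) (ell2_norm _) (ell2_norm _) (nrm a) => *; lra.
Qed.

End Completeness.

(** * Point masses, matrix entries and shifts along partial injections *)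

Section Delta.
Variables (R : realType) (X : choiceType).
Local Notation C := R[i].
Local Notation nrm := (@ComplexField.Normc.normc R).
Local Notation L2 := (ell2 R X).
Implicit Types (xi eta zeta : L2) (S T U : L2 -> L2) (A : set (L2 -> L2)).

Lemma normc_bool_sqr (b : bool) : nrm (b%:R : C) ^+ 2 = b%:R.
Proof.
by case: b; rewrite ?ComplexField.Normc.normc1 ?ComplexField.Normc.normc0 ?expr1n ?expr0n.
Qed.

Lemma delta_square_summable (x : X) :
  (fun y => (y == x)%:R : C) \in @square_summable R X.
Proof.
apply: (@sum_bounded_square_summable _ _ _ 1) => J.
under eq_bigr do rewrite normc_bool_sqr.
rewrite -natr_sum -[leRHS]/(1%:R) ler_nat.
rewrite (_ : (\sum_(y <- J) _)%N = count_mem x J); last first.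
  by rewrite -sum1_count [RHS]big_mkcond; apply: eq_bigr => y _ /=; case: (y == x).
by rewrite count_uniq_mem ?fset_uniq // leq_b1.
Qed.

Definition ell2_delta (x : X) : L2 := Ell2 (delta_square_summable x).

Lemma ell2_deltaE x y : ell2_delta x y = (y == x)%:R.
Proof. by []. Qed.

Lemma ell2_sumE (J : seq X) (F : X -> L2) y :
  (\sum_(x <- J) F x) y = \sum_(x <- J) F x y.
Proof.
by elim: J => [|x J IH]; rewrite ?big_nil ?big_cons ?ell20 // ell2D IH.
Qed.

Lemma ell2_delta_approx xi (e : R) : 0 < e -> exists J : {fset X},
  ell2_norm (xi - \sum_(x <- J) xi x *: ell2_delta x) <= e.
Proof.
move=> e0; have e20 : 0 < e ^+ 2 by rewrite exprn_gt0.
have [J0 hJ0] : exists J0 : {fset X},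
    ell2_norm xi ^+ 2 - e ^+ 2 < \sum_(x <- J0) nrm (xi x) ^+ 2.
  apply: contrapT => /forallNP h.
  have : (sqnorm xi <= (ell2_norm xi ^+ 2 - e ^+ 2)%:E)%E.
    by apply/sqnorm_leP => J; rewrite leNgt; apply/negP; exact: h.
  by rewrite sqnormE lee_fin lerBrDr gerDl leNgt e20.
exists J0; apply: ell2_norm_le => [|J]; first exact: ltW.
have E x : nrm ((xi - \sum_(x <- J0) xi x *: ell2_delta x) x) ^+ 2 =
    if x \in J0 then 0 else nrm (xi x) ^+ 2.
  rewrite ell2D ell2N ell2_sumE; case: ifPn => xJ.
    rewrite (big_fsetD1 x) // big_seq big1 => [|y]; last first.
      by rewrite !inE => /andP[yx _]; rewrite ell2Z ell2_deltaE eq_sym (negbTE yx) mulr0.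
    rewrite ell2Z ell2_deltaE eqxx mulr1 /= addr0 subrr.
    by rewrite ComplexField.Normc.normc0 expr0n.
  rewrite big_seq big1 ?subr0 // => y yJ; rewrite ell2Z ell2_deltaE.
  by case: eqP yJ xJ => [->|_ _ _]; rewrite ?mulr0 // => ->.
under eq_bigr do rewrite E.
have := sum_le_ell2_norm xi (J0 `|` J)%fset.
rewrite (big_fsetID _ (mem J0) (J0 `|` J)%fset) /=.
rewrite (_ : [fset x in (J0 `|` J)%fset | x \in J0]%fset = J0); last first.
  by apply/fsetP => x; rewrite !inE /=; case: (x \in J0); rewrite ?andbF.
rewrite (_ : \sum_(x <- J) _ = \sum_(x <- J | x \notin J0) nrm (xi x) ^+ 2);
  last by rewrite [RHS]big_mkcond /=; apply: eq_bigr => x _; case: (x \in J0).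
rewrite (_ : \sum_(x <- [fset x in (J0 `|` J)%fset | x \notin J0]%fset) _ =
    \sum_(x <- J | x \notin J0) nrm (xi x) ^+ 2); first by move: hJ0; lra.
rewrite -[RHS]big_filter; apply: perm_big; apply: uniq_perm.
- exact: fset_uniq.
- by rewrite filter_uniq // fset_uniq.
by move=> x; rewrite mem_filter !inE /=; case: (x \in J0); rewrite ?andbF ?andbT.
Qed.

(** Density of the span of the point masses, as an induction principle. *)
Lemma ell2_ind (Q : L2 -> Prop) :
    Q 0 -> (forall x, Q (ell2_delta x)) ->
    (forall (a : C) xi eta, Q xi -> Q eta -> Q (a *: xi + eta)) ->
    (forall xi, (forall e, 0 < e -> exists2 eta, Q eta & ell2_norm (xi - eta) <= e)
       -> Q xi) ->
  forall xi, Q xi.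
Proof.
move=> Q0 Qd Ql Qc xi; apply: Qc => e /(ell2_delta_approx xi) [J hJ].
exists (\sum_(x <- J) xi x *: ell2_delta x) => //.
by elim: (enum_fset J) => [|x s IH]; rewrite ?big_nil // big_cons; exact: Ql.
Qed.

Lemma linear_op0 T : linear T -> T 0 = 0.
Proof. by move=> lT; have := lT (-1) 0 0; rewrite scaler0 addr0 scaleN1r addNr. Qed.

Lemma linear_opD T xi eta : linear T -> T (xi + eta) = T xi + T eta.
Proof. by move=> lT; have := lT 1 xi eta; rewrite !scale1r. Qed.

Lemma linear_opZ T (a : C) xi : linear T -> T (a *: xi) = a *: T xi.
Proof. by move=> lT; have := lT a xi 0; rewrite !addr0 linear_op0 // addr0. Qed.

Lemma linear_opN T xi : linear T -> T (- xi) = - T xi.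
Proof. by move=> lT; rewrite -scaleN1r linear_opZ // scaleN1r. Qed.

Lemma linear_opB T xi eta : linear T -> T (xi - eta) = T xi - T eta.
Proof. by move=> lT; rewrite linear_opD // linear_opN. Qed.

Lemma bounded_op_delta_eq0 T : bounded_op T ->
  (forall x, T (ell2_delta x) = 0) -> T = 0.
Proof.
move=> bT hT; have lT := bounded_op_linear bT.
have [M [M0 hM]] := bounded_op_bound bT.
apply/funext; apply: ell2_ind => //.
- exact: linear_op0.
- by move=> a xi eta; rewrite lT => -> ->; rewrite scaler0 addr0.
move=> xi h; apply: ell2_norm0_eq0; apply: le_anti; rewrite ell2_norm_ge0 andbT.
apply/ler_addgt0Pr => e e0; rewrite add0r.
have M1 : 0 < M + 1 by rewrite ltr_pwDr.
have [eta heta he] := h _ (divr_gt0 e0 M1).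
rewrite (_ : T xi = T (xi - eta)); last by rewrite linear_opB // heta subr0.
apply: (le_trans (hM _)); apply: (le_trans (ler_wpM2l M0 he)).
by rewrite mulrCA ger_pMr // ler_pdivrMr // mul1r lerDl.
Qed.

Lemma ell2_dot_delta xi x : ell2_dot xi (ell2_delta x) = xi x.
Proof.
apply: is_sum_unique (is_sum_dot _ _) _ => e e0; exists [fset x]%fset => J.
rewrite fsub1set => xJ; rewrite (big_fsetD1 x) // big_seq big1 => [|y].
  by rewrite ell2_deltaE eqxx conjC1 mulr1 /= addr0 subrr ComplexField.Normc.normc0.
by rewrite !inE => /andP[/negbTE yx _]; rewrite ell2_deltaE yx conjC0 mulr0.
Qed.

Lemma ell2_dot_ext T eta zeta : bounded_op T ->
    (forall x, ell2_dot (T (ell2_delta x)) eta = ell2_dot (ell2_delta x) zeta) ->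
  forall xi, ell2_dot (T xi) eta = ell2_dot xi zeta.
Proof.
move=> bT hT; have lT := bounded_op_linear bT.
have [M [M0 hM]] := bounded_op_bound bT.
have d0 z : ell2_dot (0 : L2) z = 0 by rewrite -(scale0r (0 : L2)) ell2_dotZl mul0r.
apply: ell2_ind => //.
- by rewrite linear_op0 // !d0.
- by move=> a u v hu hv; rewrite lT !ell2_dotDl !ell2_dotZl hu hv.
move=> xi h; apply/eqP; rewrite -subr_eq0; apply/eqP.
apply: ComplexField.Normc.eq0_normc; apply: le_anti; rewrite normc_ge0 andbT.
apply/ler_addgt0Pr => e e0; rewrite add0r.
set K := M * ell2_norm eta + ell2_norm zeta.
have K0 : 0 <= K by rewrite addr_ge0 ?mulr_ge0 ?ell2_norm_ge0.
have K1 : 0 < K + 1 by rewrite ltr_pwDr.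
have [u hu hd] := h _ (divr_gt0 e0 K1).
rewrite (_ : _ - _ = ell2_dot (T (xi - u)) eta - ell2_dot (xi - u) zeta); last first.
  rewrite linear_opB // !ell2_dotDl !ell2_dotNl hu.
  by rewrite opprB addrA subrK.
apply: (le_trans (le_normcD _ _)); rewrite normcN.
apply: (le_trans (lerD (ell2_cauchy_schwarz _ _) (ell2_cauchy_schwarz _ _))).
apply: (@le_trans _ _ (K * ell2_norm (xi - u))).
  rewrite /K mulrDl; apply: lerD; last by rewrite mulrC.
  by rewrite mulrAC ler_wpM2r ?ell2_norm_ge0.
apply: (le_trans (ler_wpM2l K0 hd)).
by rewrite mulrCA ger_pMr // ler_pdivrMr // mul1r lerDl.
Qed.

(** Matrix entries determine bounded operators; the density argument is applied to one side of the
    inner product and then to the other. *)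
Lemma is_adjoint_delta T S : bounded_op T -> bounded_op S ->
    (forall x y, T (ell2_delta y) x = (S (ell2_delta x) y)^*) ->
  is_adjoint T S.
Proof.
move=> bT bS h.
have h1 xi x : ell2_dot (T xi) (ell2_delta x) = ell2_dot xi (S (ell2_delta x)).
  apply: ell2_dot_ext => // y.
  by rewrite ell2_dot_delta h -ell2_dot_delta ell2_dot_conj.
move=> xi eta; rewrite -ell2_dot_conj -[RHS]ell2_dot_conj; congr (_^*).
move: eta; suff h2 eta : ell2_dot (S eta) xi = ell2_dot eta (T xi) by [].
by apply: ell2_dot_ext => // x; rewrite -ell2_dot_conj -h1 ell2_dot_conj.
Qed.

Definition partial_injection (t : X -> option X) : Prop :=
  forall x x' y, t x = Some y -> t x' = Some y -> x = x'.

(** Pull-back along [t], with value 0 where [t] is undefined. The default of [insubd] would only be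
    taken if the pull-back were not square-summable, which a partial injection excludes. *)
Definition shift_op (t : X -> option X) : L2 -> L2 :=
  fun xi => insubd (0 : L2) (fun x => oapp xi 0 (t x)).

Lemma partial_injection_sum_le (t : X -> option X) xi (J : {fset X}) :
  partial_injection t ->
  \sum_(x <- J) nrm (oapp xi 0 (t x)) ^+ 2 <= ell2_norm xi ^+ 2.
Proof.
move=> tI; set s := pmap t J.
have us : uniq s.
  rewrite /s; elim: (enum_fset J) (fset_uniq J) => [//|x r IH] /= /andP[xr /IH ur].
  case tx : (t x) => [y|] //=; rewrite ur andbT.
  apply: contra xr; rewrite mem_pmap => /mapP[x' x'r /esym tx'].
  by rewrite (tI _ _ _ tx tx').
apply: le_trans (sum_le_ell2_norm xi [fset y in s]%fset).
rewrite (_ : \sum_(x <- [fset y in s]%fset) _ = \sum_(y <- s) nrm (xi y) ^+ 2).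
  rewrite /s; elim: (enum_fset J) => [|x r IH]; rewrite ?big_nil // big_cons.
  rewrite [pmap _ _]/=; case: (t x) => [y|]; rewrite /oapp.
    by rewrite big_cons lerD2l.
  by rewrite ComplexField.Normc.normc0 expr0n add0r.
apply: perm_big; apply: uniq_perm; rewrite ?fset_uniq // => y.
by rewrite !inE.
Qed.

Lemma shift_opE (t : X -> option X) : partial_injection t ->
  forall xi x, shift_op t xi x = oapp xi 0 (t x).
Proof.
move=> tI xi x; rewrite /shift_op -[ell2_val _]/(val _) val_insubd.
by rewrite (sum_bounded_square_summable (fun J => partial_injection_sum_le xi J tI)).
Qed.

Lemma shift_op_le (t : X -> option X) : partial_injection t ->
  op_le (shift_op t) 1.
Proof.
move=> tI; split=> // xi; rewrite mul1r; apply: ell2_norm_le => [|J].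
  exact: ell2_norm_ge0.
by under eq_bigr do rewrite shift_opE //; exact: partial_injection_sum_le.
Qed.

Lemma shift_op_bounded (t : X -> option X) : partial_injection t ->
  bounded_op (shift_op t).
Proof.
move=> tI; apply/bounded_opP; split; last by exists 1; exact: shift_op_le.
move=> a u v; apply: ell2P => x; rewrite !(ell2D, ell2Z, shift_opE) //.
by case: (t x) => [y|] //=; rewrite mulr0 addr0.
Qed.

Lemma shift_op_adjoint (t t' : X -> option X) :
    (forall x y, t x = Some y <-> t' y = Some x) ->
  is_adjoint (shift_op t) (shift_op t').
Proof.
move=> tt'.
have tI : partial_injection t by move=> x x' y /tt' + /tt' => -> [].
have tI' : partial_injection t' by move=> x x' y /tt' + /tt' => -> [].
apply: is_adjoint_delta; [exact: shift_op_bounded|exact: shift_op_bounded|].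
move=> x y.
rewrite !shift_opE //.
rewrite /oapp; case tx : (t x) => [z|]; last first.
  case ty : (t' y) => [w|]; rewrite ?conjC0 //.
  rewrite ell2_deltaE; case: eqP ty => [->|_]; rewrite ?conjC0 //.
  by move=> /tt'; rewrite tx.
rewrite ell2_deltaE; case: eqP tx => [-> /tt' ->|zy tx].
  by rewrite ell2_deltaE eqxx conjC1.
case ty : (t' y) => [w|]; rewrite ?conjC0 // ell2_deltaE.
case: eqP ty => [->|_]; rewrite ?conjC0 //.
by move=> /tt'; rewrite tx => -[].
Qed.

End Delta.

(** * Norm closures, fixed points and inverse square roots *)

Section OperatorAlgebra.
Variables (R : realType) (X : choiceType).
Local Notation C := R[i].
Local Notation nrm := (@ComplexField.Normc.normc R).
Local Notation L2 := (ell2 R X).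
Implicit Types (xi eta zeta : L2) (S T U : L2 -> L2) (A B : set (L2 -> L2)).

Lemma scaled_eps_le (N e : R) : 0 <= N -> 0 < e -> N * (e / (N + 1)) <= e.
Proof.
move=> N0 e0; have N1 : 0 < N + 1 by rewrite ltr_pwDr.
by rewrite mulrCA ger_pMr // ler_pdivrMr // mul1r lerDl.
Qed.

Lemma op_comp_sub S T U : linear U -> U \o (S - T) = (U \o S) - (U \o T).
Proof. by move=> lU; apply/funext => xi; exact: linear_opB. Qed.

Lemma op_distD S T S' T' M N : op_le (S - S') M -> op_le (T - T') N ->
  op_le ((S + T) - (S' + T')) (M + N).
Proof. by move=> h1 h2; rewrite opprD addrACA; exact: op_leD. Qed.

Lemma op_dist_trans S T U M N : op_le (S - T) M -> op_le (T - U) N ->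
  op_le (S - U) (M + N).
Proof. by move=> h1 h2; rewrite -(subrK T S) -addrA; exact: op_leD. Qed.

Lemma norm_closure_subset A : A `<=` @bounded_op R X -> A `<=` norm_closure A.
Proof.
move=> bA T AT; apply/(norm_closureP _ bA); split; first exact: bA.
by move=> e e0; exists T => //; rewrite subrr; apply: op_le_weaken (op_le0 _ _) (ltW e0).
Qed.

Lemma norm_closure_closed_subspace A :
    A `<=` @bounded_op R X -> A 0 ->
    (forall S T, A S -> A T -> A (S + T)) ->
    (forall (c : C) S, A S -> A (c *: S)) ->
  closed_subspace (norm_closure A).
Proof.
move=> bA A0 AD AZ; split.
- by move=> T [].
- exact: norm_closure_subset.
- move=> S T /(norm_closureP _ bA) [bS hS] /(norm_closureP _ bA) [bT hT].
  apply/(norm_closureP _ bA); split; first exact: bounded_opD.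
  move=> e e0; have e2 : 0 < e / 2 by rewrite divr_gt0.
  have [S' AS' hS'] := hS _ e2; have [T' AT' hT'] := hT _ e2.
  exists (S' + T'); first exact: AD.
  by rewrite (splitr e); exact: op_distD.
- move=> c S /(norm_closureP _ bA) [bS hS].
  apply/(norm_closureP _ bA); split; first exact: bounded_opZ.
  move=> e e0; have c1 : 0 < nrm c + 1 by rewrite ltr_pwDr // normc_ge0.
  have [S' AS' hS'] := hS _ (divr_gt0 e0 c1); exists (c *: S'); first exact: AZ.
  rewrite -scalerBr; apply: op_le_weaken (op_leZ c hS') _.
  exact: scaled_eps_le (normc_ge0 _) e0.
have bcA : norm_closure A `<=` @bounded_op R X by move=> T [].
move=> T /(norm_closureP _ bcA) [bT hT].
apply/(norm_closureP _ bA); split => // e e0.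
have e2 : 0 < e / 2 by rewrite divr_gt0.
have [T' /(norm_closureP _ bA) [_ hT'] hTT'] := hT _ e2.
have [T'' AT'' h] := hT' _ e2; exists T'' => //.
by rewrite (splitr e); exact: op_dist_trans hTT' h.
Qed.

Lemma norm_closure_comp A :
    A `<=` @bounded_op R X -> (forall S T, A S -> A T -> A (S \o T)) ->
  forall S T, norm_closure A S -> norm_closure A T -> norm_closure A (S \o T).
Proof.
move=> bA AM S T /(norm_closureP _ bA) [bS hS] /(norm_closureP _ bA) [bT hT].
apply/(norm_closureP _ bA); split; first exact: bounded_op_comp.
move=> e e0; have e2 : 0 < e / 2 by rewrite divr_gt0.
have [N [N0 hN]] := bounded_op_bound bT.
have [S' AS' hS'] := hS _ (divr_gt0 e2 (ltr_wpDl N0 ltr01)).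
(* The order of choices matters: the tolerance for [T'] depends on the bound of the approximant
   [S']. *)
have [M [M0 hM]] := bounded_op_bound (bA _ AS').
have [T' AT' hT'] := hT _ (divr_gt0 e2 (ltr_wpDl M0 ltr01)).
exists (S' \o T'); first exact: AM.
rewrite (_ : _ - _ = ((S - S') \o T) + (S' \o (T - T'))); last first.
  rewrite op_comp_sub; last exact: bounded_op_linear (bA _ AS').
  rewrite addrA; congr (_ - _).
  by apply/funext => xi; rewrite -[LHS]/(S (T xi)) -[RHS]/(S (T xi) - S' (T xi) + S' (T xi)) subrK.
rewrite (splitr e); apply: op_leD.
  apply: op_le_weaken (op_le_comp hS' (conj N0 hN)) _.
  by rewrite mulrC; exact: scaled_eps_le.
by apply: op_le_weaken (op_le_comp (conj M0 hM) hT') _; exact: scaled_eps_le.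
Qed.

(** Banach's fixed-point theorem on a norm-closed set of bounded operators. The contraction is
    expressed through arbitrary bounds [d], and the factor 1/2 makes the iterates converge
    geometrically. *)
Lemma op_fixpoint (Q : set (L2 -> L2)) (F : (L2 -> L2) -> (L2 -> L2)) y0 :
    Q y0 -> Q `<=` @bounded_op R X ->
    (forall T, bounded_op T ->
       (forall e, 0 < e -> exists2 S, Q S & op_le (T - S) e) -> Q T) ->
    (forall T, Q T -> Q (F T)) ->
    (forall S T d, Q S -> Q T -> op_le (S - T) d ->
       op_le (F S - F T) (d * 2^-1)) ->
  exists2 T, Q T & F T = T.
Proof.
move=> Qy0 bQ Qc QF cF.
pose s n := iter n F y0.
have Qs n : Q (s n) by elim: n => //= n; exact: QF.
have [c hc] := bounded_op_bound (bounded_opB (bQ _ (Qs 1%N)) (bQ _ Qy0)).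
have hs n : op_le (s n.+1 - s n) (c * 2^-1 ^+ n).
  elim: n => [|n IH]; first by rewrite expr0 mulr1; exact: hc.
  by rewrite exprSr mulrA; exact: (cF _ _ _ (Qs n.+1) (Qs n) IH).
have [T bT hT] := op_geometric_limit (fun n => bounded_op_linear (bQ _ (Qs n)))
  (bounded_op_bound (bQ _ (Qs 0%N))) hc.1 hs.
have QT : Q T.
  apply: Qc => // e e0; have [n hn] := half_expn_small (4 * c) e0.
  by exists (s n) => //; exact: op_le_weaken (hT n) (ltW hn).
exists T => //; apply/eqP; rewrite -subr_eq0; apply/eqP; apply: op_le_small_eq0.
move=> e e0; have [n hn] := half_expn_small (4 * c) e0.
have h1 := cF _ _ _ QT (Qs n) (hT n).
apply: op_le_weaken (op_dist_trans h1 (op_le_sym (hT n.+1))) _.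
rewrite exprSr; lra.
Qed.

Lemma op_le_limit T M :
  (forall e, 0 < e -> exists2 S, op_le S M & op_le (T - S) e) -> op_le T M.
Proof.
move=> h; split=> [|xi]; first by have [S []] := h 1 ltr01.
apply/ler_addgt0Pr => e e0.
have [S hS hTS] := h _ (divr_gt0 e0 (ltr_wpDl (ell2_norm_ge0 xi) ltr01)).
rewrite (_ : T xi = S xi + (T - S) xi); last first.
  by rewrite -[(T - S) xi]/(T xi - S xi) addrC subrK.
apply: (le_trans (ell2_normD _ _)); apply: lerD; first exact: hS.2.
apply: (le_trans (hTS.2 xi)); rewrite mulrC.
by apply: scaled_eps_le => //; exact: ell2_norm_ge0.
Qed.

Lemma is_adjoint_limit T :
  (forall e, 0 < e -> exists2 S, is_adjoint S S & op_le (T - S) e) ->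
  is_adjoint T T.
Proof.
move=> h xi eta; apply/eqP; rewrite -subr_eq0; apply/eqP.
apply: ComplexField.Normc.eq0_normc; apply: le_anti; rewrite normc_ge0 andbT.
apply/ler_addgt0Pr => e e0; rewrite add0r.
set K := 2 * (ell2_norm xi * ell2_norm eta).
have K0 : 0 <= K by rewrite !mulr_ge0 ?ell2_norm_ge0.
have [S hS hTS] := h _ (divr_gt0 e0 (ltr_wpDl K0 ltr01)).
rewrite (_ : _ - _ = ell2_dot ((T - S) xi) eta - ell2_dot xi ((T - S) eta)).
  apply: (le_trans (le_normcD _ _)); rewrite normcN.
  apply: (le_trans (lerD (ell2_cauchy_schwarz _ _) (ell2_cauchy_schwarz _ _))).
  apply: le_trans (scaled_eps_le K0 e0).
  have h1 := ler_wpM2r (ell2_norm_ge0 eta) (hTS.2 xi).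
  have h2 := ler_wpM2l (ell2_norm_ge0 xi) (hTS.2 eta).
  by apply: (le_trans (lerD h1 h2)); rewrite /K le_eqVlt; apply/orP; left; apply/eqP; ring.
rewrite -[(T - S) xi]/(T xi - S xi) -[(T - S) eta]/(T eta - S eta).
rewrite ell2_dotDl ell2_dotDr ell2_dotNl ell2_dotNr hS.
by rewrite opprD opprK addrACA addNr addr0.
Qed.

Lemma inverse_sqrt A x : closed_subspace A -> A id ->
    (forall S T, A S -> A T -> A (S \o T)) ->
    A x -> is_adjoint x x -> op_le x 16^-1 ->
  exists z, [/\ A z, is_adjoint z z & z \o (id - x) \o z = id].
Proof.
move=> [bA A0 AD AZ Ac] A1 AM Ax sx hx.
pose h : C := (2^-1 : R)%:C%C.
(* [z = id + y] solves the equation iff [y] is a fixed point of the contraction [F]. *)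
pose F (y : L2 -> L2) : L2 -> L2 :=
  h *: (((id + y) \o x \o (id + y)) - (y \o y)).
(* With |x| <= 1/16 the map [F] preserves the ball of radius 1/4, as ((5/4)^2 / 16 + 1/16) / 2 <
   1/4, and has Lipschitz constant at most (2 (5/4) / 16 + 2/4) / 2 = 21/64 < 1/2. All three
   conditions in [Q] pass to norm limits. *)
pose Q : set (L2 -> L2) := [set y | [/\ A y, op_le y 4^-1 & is_adjoint y y]].
have nh : nrm h = 2^-1 by rewrite normc_complex ger0_norm.
have lx := bounded_op_linear (bA _ Ax).
have le1 (y : L2 -> L2) : op_le y 4^-1 -> op_le (id + y) (1 + 4^-1).
  by move=> hy; apply: op_leD => //; exact: op_le_id.
have AN S : A S -> A (- S) by rewrite -scaleN1r; apply: AZ.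
have [|||||Y [AY hY sY] FY] := @op_fixpoint Q F 0.
- split=> //; last exact: is_adjoint0.
  by apply: op_le_weaken (op_le0 _ _) _; rewrite invr_ge0.
- by move=> y [/bA].
- move=> T bT hT; split.
  + apply: Ac; apply/(norm_closureP _ bA); split=> // e /hT [S [AS _ _] ?].
    by exists S.
  + by apply: op_le_limit => e /hT [S [_ hS _] ?]; exists S.
  + by apply: is_adjoint_limit => e /hT [S [_ _ hS] ?]; exists S.
- move=> y [Ay hy sy]; split.
  + apply/AZ/AD; last by apply/AN/AM.
    by apply: (AM) (AD _ _ A1 Ay); apply: (AM) Ax; exact: AD.
  + have h1 := op_le_comp (op_le_comp (le1 _ hy) hx) (le1 _ hy).
    have h2 := op_leZ h (op_leB h1 (op_le_comp hy hy)).
    by apply: op_le_weaken h2 _; rewrite nh; lra.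
  + have s1 : is_adjoint (id + y) (id + y) by apply: is_adjointD.
    apply: is_adjointZ; apply: is_adjointD; last exact/is_adjointN/is_adjoint_comp.
    exact: is_adjoint_comp (is_adjoint_comp s1 sx) s1.
- move=> S T d [AS hS _] [AT hT _] hd.
  have lS := bounded_op_linear (bA _ AS); have lT := bounded_op_linear (bA _ AT).
  have -> : F S - F T = h *: (((S - T) \o x \o (id + S)) + ((id + T) \o x \o (S - T))
      - ((S \o (S - T)) + ((S - T) \o T))).
    rewrite /F -scalerBr; congr (_ *: _); apply/funext => xi.
    rewrite -[LHS]/((x (xi + S xi) + S (x (xi + S xi))) - S (S xi)
       - ((x (xi + T xi) + T (x (xi + T xi))) - T (T xi))).
    rewrite -[RHS]/((S (x (xi + S xi)) - T (x (xi + S xi)))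
       + (x (S xi - T xi) + T (x (S xi - T xi))) -
       (S (S xi - T xi) + (S (T xi) - T (T xi)))).
    have xD u v := linear_opD u v lx; have xB u v := linear_opB u v lx.
    have SD u v := linear_opD u v lS; have SB u v := linear_opB u v lS.
    have TD u v := linear_opD u v lT; have TB u v := linear_opB u v lT.
    rewrite !(xB, SB, TB, xD, SD, TD).
    apply: ell2P => i; rewrite !(ell2D, ell2N); ring.
  have h1 := op_leD (op_le_comp (op_le_comp hd hx) (le1 _ hS))
                    (op_le_comp (op_le_comp (le1 _ hT) hx) hd).
  have h2 := op_leD (op_le_comp hS hd) (op_le_comp hd hT).
  apply: op_le_weaken (op_leZ h (op_leB h1 h2)) _; rewrite nh.
  by have := hd.1; lra.
have lY := bounded_op_linear (bA _ AY).
exists (id + Y); split; [exact: AD|exact: is_adjointD|].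
apply/funext => xi.
have E : 2%:R *: Y xi = (x (xi + Y xi) + Y (x (xi + Y xi))) - Y (Y xi).
  rewrite -{1}FY -[F Y xi]/(h *: ((x (xi + Y xi) + Y (x (xi + Y xi))) - Y (Y xi))).
  by rewrite scalerA /h fmorphV rmorph_nat mulfV ?pnatr_eq0 // scale1r.
rewrite -[LHS]/((xi + Y xi - x (xi + Y xi)) + Y (xi + Y xi - x (xi + Y xi))).
rewrite (linear_opB _ _ lY) (linear_opD _ _ lY) /=.
apply: ell2P => i; have := congr1 (fun u : L2 => u i) E.
rewrite !(ell2D, ell2N, ell2Z) => E'.
move: E'; move: (xi i) (Y xi i) (Y (Y xi) i) (x (xi + Y xi) i)
  (Y (x (xi + Y xi)) i) => a b c d e E'.
have -> : a + b - d + (b + c - e) = a + (2 * b - (d + e - c)) by ring.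
by rewrite E' subrr addr0.
Qed.

Lemma ideal_near_id A I T : closed_ideal A I -> A id -> I T ->
  op_le (id - T) 2^-1 -> I = A.
Proof.
move=> [[bI I0 ID IZ Ic] IA IAl IAr] A1 IT hT.
suff I1 : I id.
  by apply/seteqP; split=> // S AS; exact: (IAl S id).
have IN S : I S -> I (- S) by rewrite -scaleN1r; apply: IZ.
(* [id - (id - T)^n] is in [I] and converges to [id]. *)
pose r n := iter n (fun S => (id - T) \o S) id.
have hr n : I (id - r n).
  elim: n => [|n IH]; first by rewrite subrr.
  have -> : id - r n.+1 = (T \o r n) + (id - r n).
    apply/funext => xi.
    rewrite -[LHS]/(xi - (r n xi - T (r n xi))) -[RHS]/(T (r n xi) + (xi - r n xi)).
    by apply: ell2P => i; rewrite !(ell2D, ell2N); ring.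
  apply: (ID) => //.
  rewrite (_ : T \o r n = T - (T \o (id - r n))); first by apply: (ID) => //; apply/IN/IAl/IH/IA.
  rewrite op_comp_sub; last exact: bounded_op_linear (bI _ IT).
  by rewrite opprB addrC subrK.
apply: Ic; apply/(norm_closureP _ bI); split; first exact: bounded_op_id.
move=> e e0; have [n hn] := half_expn_small 1 e0; exists (id - r n) => //.
rewrite opprB addrC subrK; rewrite mul1r in hn.
apply: (@op_le_weaken _ _ _ (2^-1 ^+ n)); last exact: ltW.
elim: n {hn} => [|n IH]; first by rewrite expr0; exact: op_le_id.
by rewrite exprS; exact: op_le_comp.
Qed.

End OperatorAlgebra.

(** * Criteria for pure infiniteness and for simplicity *)

Section PurelyInfinite.
Variables (R : realType) (X : choiceType).
Local Notation C := R[i].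
Local Notation nrm := (@ComplexField.Normc.normc R).
Local Notation L2 := (ell2 R X).
Implicit Types (xi eta zeta : L2) (S T U : L2 -> L2) (A B : set (L2 -> L2)).

(** The diagonal entry of b^* b at x is the squared norm of the column [b (ell2_delta R x)], so a
    non-zero column can be scaled to make the entry 1, the form that compression to the identity
    requires. *)
Lemma subalgebra_diag_one B : Cstar_algebra B -> (exists2 b, B b & b <> 0) ->
  exists b d x, [/\ B b, B d, is_adjoint b d & d (b (ell2_delta R x)) x = 1].
Proof.
move=> [[bB B0 BD BZ Bc] BM Bs] [b Bb b0]; have [d Bd bd] := Bs _ Bb.
have [x bx] : exists x, b (ell2_delta R x) <> 0.
  apply: contrapT => /forallNP h; apply: b0; apply: bounded_op_delta_eq0.
    exact: bB.
  by move=> x; apply: contrapT; exact: h.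
set n := ell2_norm (b (ell2_delta R x)).
have n0 : n != 0 by apply/eqP => /ell2_norm0_eq0.
have E : d (b (ell2_delta R x)) x = (n ^+ 2)%:C%C.
  rewrite -ell2_dot_delta -ell2_dotxx -ell2_dot_conj -(ell2_dot_conj (b _)).
  by rewrite bd.
exists (n^-1%:C%C *: b), (n^-1%:C%C *: d), x; split; [exact: BZ|exact: BZ|exact: is_adjointZ|].
rewrite -[LHS]/(n^-1%:C%C * d (n^-1%:C%C *: b (ell2_delta R x)) x).
rewrite (linear_opZ _ _ (bounded_op_linear (bB _ Bd))) ell2Z E -!rmorphM /=.
by rewrite expr2 mulKf // mulVf.
Qed.

Lemma hereditary_compress A B b d v v' : (forall S T, A S -> A T -> A (S \o T)) ->
    closed_subspace A -> A id ->
    hereditary_subalgebra A B -> B b -> B d -> is_adjoint b d ->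
    A v -> A v' -> is_adjoint v v' -> v' \o v = id ->
  B (b \o v \o v' \o d).
Proof.
move=> AM [bA A0 AD AZ Ac] A1 [[[bB B0 BD BZ Bc] BM Bs] BA her] Bb Bd bd Av Av' vv' vK.
have AN S : A S -> A (- S) by rewrite -scaleN1r; apply: AZ.
have lb := bounded_op_linear (bB _ Bb).
have lv' := bounded_op_linear (bA _ Av').
have lv := bounded_op_linear (bA _ Av).
have vv v0 : v' (v v0) = v0 by rewrite -[LHS]/((v' \o v) v0) vK.
have Ab := BA _ Bb; have Ad := BA _ Bd.
(* [b v v' d] is positive and dominated by [b d]. *)
apply: (her _ (b \o d)); first exact: BM.
  exists (v' \o d), (b \o v); split=> //; [exact: AM|exact: AM|].
  by apply: is_adjoint_comp; apply: is_adjoint_sym.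
exists ((id - (v \o v')) \o d), (b \o (id - (v \o v'))).
have A3 : A (id - (v \o v')) by apply: AD => //; apply: AN; exact: AM.
split; [exact: AM|exact: AM|apply: is_adjoint_comp|].
- apply: is_adjointD => //; apply: is_adjointN; apply: is_adjoint_comp => //.
  exact: is_adjoint_sym.
- exact: is_adjoint_sym.
apply/funext => xi; rewrite -[LHS]/(b (d xi) - b (v (v' (d xi)))).
rewrite -[RHS]/(b ((d xi - v (v' (d xi))) - v (v' (d xi - v (v' (d xi)))))).
by rewrite (linear_opB _ _ lv') vv subrr (linear_op0 lv) subr0 (linear_opB _ _ lb).
Qed.

Lemma purely_infinite_criterion A :
    closed_subspace A -> A id -> (forall S T, A S -> A T -> A (S \o T)) ->
    (forall T x e, A T -> T (ell2_delta R x) x = 1 -> 0 < e ->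
      exists v v', [/\ A v, A v', is_adjoint v v', v' \o v = id &
        op_le ((v' \o T \o v) - id) e]) ->
    (exists s s', [/\ A s, A s', is_adjoint s s', s' \o s = id & s \o s' <> id]) ->
  forall B, hereditary_subalgebra A B -> (exists2 b, B b & b <> 0) ->
    exists2 p, B p & infinite_projection A p.
Proof.
move=> cA A1 AM key [s [s' [As As' ss' sK sN]]] B hB Bn0.
have [CB BA _] := hB.
have [b [d [x [Bb Bd bd bdx]]]] := subalgebra_diag_one CB Bn0.
have [[bA A0 AD AZ Ac] [[bB B0 BD BZ Bc] BM Bs]] := (cA, CB).
(* The tolerance under which [inverse_sqrt] applies to [id - D]. *)
have e0 : (0 : R) < 16^-1 by rewrite invr_gt0.
have Ab := BA _ Bb; have Ad := BA _ Bd.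
have [v [v' [Av Av' vv' vK hv]]] := key _ _ _ (AM _ _ Ad Ab) bdx e0.
pose D : L2 -> L2 := v' \o d \o b \o v.
have AD' : A D by apply: (AM) Av; apply: (AM) Ab; exact: AM.
have AN S : A S -> A (- S) by rewrite -scaleN1r; apply: AZ.
pose y := id - D.
have sD : is_adjoint D D.
  move=> xi eta; rewrite /D /=.
  by rewrite (is_adjoint_sym vv') (is_adjoint_sym bd) bd vv'.
have [|||z [Az sz zK]] := @inverse_sqrt _ _ A y cA A1 AM.
- by apply: (AD) => //; exact: AN.
- by apply: is_adjointD => //; exact: is_adjointN.
- exact: op_le_sym.
have zD xi : z (D (z xi)) = xi.
  by rewrite -[RHS]/(id xi) -zK /y opprB addrC subrK.
have lz := bounded_op_linear (bA _ Az); have lb := bounded_op_linear (bA _ Ab).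
have ld := bounded_op_linear (bA _ Ad); have lv := bounded_op_linear (bA _ Av).
have lv' := bounded_op_linear (bA _ Av'); have lD := bounded_op_linear (bA _ AD').
(* From z D z = 1 alone: D z = (z D z) D z = z D (z D z) = z D. *)
have zD' xi : D (z xi) = z (D xi) by rewrite -[LHS]zD (zD xi).
pose u : L2 -> L2 := b \o v \o z; pose u' : L2 -> L2 := z \o v' \o d.
have Au : A u by apply: (AM) Az; exact: AM.
have Au' : A u' by apply: (AM) Ad; exact: AM.
have uu' : is_adjoint u u'.
  by move=> xi eta; rewrite /u /u' /= bd vv' sz.
have uK xi : u' (u xi) = xi by rewrite -[RHS]zD.
pose q := u \o u'.
pose a : L2 -> L2 := b \o v \o v' \o d.
have Ba : B a by apply: (@hereditary_compress A B).
(* [q] is in [B] as the limit of [1 - (1 - a)^n], polynomials in [a = b v v' d]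
   without constant term. *)
pose p n := iter n (fun S => a + S - (a \o S)) 0.
have Bp n : B (p n).
  elim: n => [//|n IH]; apply: (BD); first exact: BD.
  by rewrite -scaleN1r; apply/BZ/BM.
have la := bounded_op_linear (bB _ Ba).
pose w n := iter n (fun T => y \o T) (z \o u').
have Ay : A y by apply: AD => //; exact: AN.
have ly := bounded_op_linear (bA _ Ay).
(* Since a q = a, the recursion reads q - p_(n+1) = (1 - a)(q - p_n); and a b v = b v D gives (1 -
   a) b v = b v y. Each step thus contributes one factor [y], of norm at most 1/16. *)
have qp n : q - p n = b \o v \o w n.
  elim: n => [|n IH]; first by rewrite subr0.
  apply/funext => xi; have := congr1 (fun T => T xi) IH.
  rewrite -[(q - p n) xi]/(q xi - p n xi) -[(b \o v \o w n) xi]/(b (v (w n xi))) => IHx.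
  rewrite -[LHS]/(q xi - (a xi + p n xi - a (p n xi))).
  rewrite -[RHS]/(b (v (w n xi - D (w n xi)))).
  have aq : a (q xi) = a xi.
    by rewrite -[LHS]/(b (v (D (z (z (v' (d xi))))))) zD' zD.
  rewrite (linear_opB _ _ lv) (linear_opB _ _ lb) -IHx.
  rewrite -[b (v (D _))]/(a (b (v (w n xi)))) -IHx (linear_opB _ _ la) aq.
  by apply: ell2P => i; rewrite !(ell2D, ell2N); ring.
have Bq : B q.
  apply: Bc; apply/(norm_closureP _ bB); split; first exact/bA/AM.
  move=> e e1.
  have [M hM] := bounded_op_bound (bA _ (AM _ _ Ab Av)).
  have [N hN] := bounded_op_bound (bA _ (AM _ _ Az Au')).
  have [n hn] := half_expn_small (M * N) e1.
  exists (p n) => //; rewrite qp.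
  have hw : op_le (w n) (2^-1 ^+ n * N).
    elim: n {hn} => [|n IH]; first by rewrite expr0 mul1r.
    rewrite exprS -mulrA; apply: op_le_comp IH.
    by apply: op_le_weaken (op_le_sym hv) _; lra.
  apply: op_le_weaken (op_le_comp hM hw) _.
  by rewrite mulrCA mulrC; exact: ltW.
have pq : projection q.
  split; first by apply/funext => xi; rewrite /q /= uK.
  by apply: is_adjoint_comp => //; exact: is_adjoint_sym.
exists q => //; split; [exact: BA|by []|].
exists (u \o s \o u'), (u \o s' \o u').
have sK' xi : s' (s xi) = xi by rewrite -[LHS]/((s' \o s) xi) sK.
split; [by apply: (AM) Au'; exact: AM|by apply: (AM) Au'; exact: AM| | |split].
- move=> xi eta; rewrite /= uu' ss'.
  by rewrite (is_adjoint_sym uu').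
- by apply/funext => xi; rewrite /= uK sK'.
- by apply/funext => xi; rewrite /q /= !uK.
move=> h; apply: sN; apply/funext => xi.
have := congr1 (fun T => u' (T (u xi))) h.
by rewrite /q /= !uK.
Qed.

(** An ideal is two-sided, so [v] and [v'] need not be related. The tolerance is relative to [c]:
    dividing by [c] leaves the distance 1/2 that [ideal_near_id] accepts. *)
Lemma simple_criterion A : A id -> (id : L2 -> L2) <> 0 ->
    (forall T, A T -> T <> 0 -> exists v v',
      [/\ A v, A v' & exists2 c : C, c <> 0 &
        op_le ((v' \o T \o v) - c *: id) (nrm c * 2^-1)]) ->
  Cstar_simple A.
Proof.
move=> A1 nz key; split; first by exists id.
move=> I hI; have [[bI I0 ID IZ Ic] IA IAl IAr] := hI.
have [h|/existsNP [T /not_implyP [IT T0]]] := pselect (forall T, I T -> T = 0).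
  by left; apply/seteqP; split=> [T /h|T ->].
right; have [v [v' [Av Av' [c c0 hc]]]] := key _ (IA _ IT) T0.
have nc : nrm c != 0 by apply/eqP => /ComplexField.Normc.eq0_normc.
apply: (@ideal_near_id _ _ A I (c^-1 *: (v' \o T \o v))) => //.
  by apply: IZ; apply: (IAr) Av; exact: IAl.
rewrite (_ : id - _ = - (c^-1 *: ((v' \o T \o v) - c *: id))).
  apply: op_leN; apply: op_le_weaken (op_leZ c^-1 hc) _.
  by rewrite ComplexField.Normc.normcV mulKf.
by rewrite scalerBr scalerA mulVf ?scale1r ?opprB //; apply/eqP.
Qed.

End PurelyInfinite.

(** * Characters of the semilattice of constructible ideals *)

Section Characters.
Local Open Scope group_scope.
Variables (G : groupType) (P : set G).
Hypothesis hP : monoid_closed (mem P).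
Implicit Types (chi psi : charJ P) (X Y Z : cset P) (s t : set (G * G)) (g h k p q : G).

Lemma submonoid1 : P 1.
Proof. by case: hP => /set_mem. Qed.

Lemma submonoidM p q : P p -> P q -> P (p * q).
Proof. by case: hP => _ hM Pp Pq; apply/set_mem/hM; exact: mem_set. Qed.

Lemma csetP X : constructible P (set_val X).
Proof. exact: set_valP. Qed.

Lemma cset_ext X Y : (forall x, set_val X x <-> set_val Y x) -> X = Y.
Proof. by move=> h; apply: val_inj; apply/seteqP; split=> x /h. Qed.

Lemma hull_sub s x y : left_inverse_hull P s -> s (x, y) -> P x /\ P y.
Proof.
move=> hs; elim: hs x y => [p Pp|{}s _ IH|{}s t _ IHs _ IHt] x y /=.
- by move=> [Px ->]; split=> //; exact: submonoidM.
- by move=> /IH [].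
by move=> [z /IHt [Px _] /IHs [_ Py]].
Qed.

(** This equivariance makes the constructible sets right ideals of P. *)
Lemma hull_mulr s x y q : left_inverse_hull P s -> s (x, y) -> P q ->
  s (x * q, y * q).
Proof.
move=> hs + Pq; elim: hs x y => [p Pp|{}s _ IH|{}s t _ IHs _ IHt] x y /=.
- by move=> [Px ->]; rewrite mulgA; split=> //; exact: submonoidM.
- exact: IH.
by move=> [z /IHt tz /IHs sz]; exists (z * q).
Qed.

Lemma sigma_eq_inv s g : sigma_eq s g -> sigma_eq (s^-1)%relation g^-1.
Proof.
move=> [[[x y] sxy] hg]; split; first by exists (y, x).
by move=> [a b] /= /hg /= ->; rewrite mulKg.
Qed.

Lemma cset_sub X x : set_val X x -> P x.
Proof.
by have [s hs <-] := csetP X; move=> [[x' y] sxy /= <-]; exact: (hull_sub hs sxy).1.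
Qed.

Lemma cset_mulr X x q : set_val X x -> P q -> set_val X (x * q).
Proof.
have [s hs <-] := csetP X; move=> [[x' y] sxy /= <-] Pq.
by exists (x' * q, y * q) => //; exact: hull_mulr.
Qed.

Definition mul_graph p : set (G * G) := [set xy | P xy.1 /\ xy.2 = p * xy.1].

Lemma sigma_eq_mul p : sigma_eq (mul_graph p) p.
Proof.
split; last by move=> xy [].
by exists (1, p); split; [exact: submonoid1|rewrite /= mulg1].
Qed.

Definition principal p (Pp : P p) : cset P := cdom (lih_inv (lih_mul Pp)).

Lemma principalE p (Pp : P p) x :
  set_val (principal Pp) x <-> exists2 y, P y & x = p * y.
Proof.
split=> [[[x' y] [/= Py ->] /= <-]|[y Py ->]]; first by exists y.
by exists (p * y, y).
Qed.

Lemma principal_sub p (Pp : P p) X : set_val X p ->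
  set_val (principal Pp) `<=` set_val X.
Proof. by move=> Xp x /principalE [y Py ->]; exact: cset_mulr. Qed.

Lemma principal_mem p (Pp : P p) : set_val (principal Pp) p.
Proof. by apply/principalE; exists 1; rewrite ?mulg1 //; exact: submonoid1. Qed.

Definition cfull : cset P := cdom (lih_mul submonoid1).

Lemma cfullE x : set_val cfull x <-> P x.
Proof.
split=> [[[x' y] [/= Px _] /= <-] //|Px].
by exists (x, 1 * x).
Qed.

Lemma Jhat_mono chi X Y : Jhat chi -> set_val X `<=` set_val Y -> chi X -> chi Y.
Proof.
move=> [_ chiI _] XY cX; have : chi (csetI X Y).
  rewrite (_ : csetI X Y = X) //; apply: cset_ext => x /=.
  by split=> [[]//|Xx]; split=> //; exact: XY.
by rewrite chiI => /andP[].
Qed.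

Lemma Jhat_full chi : Jhat chi -> chi cfull.
Proof.
move=> hc; have [[X cX] _ _] := hc; apply: (Jhat_mono hc _ cX) => x Xx.
by apply/cfullE; exact: cset_sub Xx.
Qed.

Lemma Jhat_nonempty chi X : Jhat chi -> chi X -> set_val X !=set0.
Proof.
move=> [_ _ c0] cX; apply/set0P/eqP => /c0; by rewrite cX.
Qed.

Lemma JhatI chi X Y : Jhat chi -> chi X -> chi Y -> chi (csetI X Y).
Proof. by move=> [_ chiI _] cX cY; rewrite chiI cX cY. Qed.

Lemma cpre_dom s t (hs : left_inverse_hull P s) (ht : left_inverse_hull P t) :
  cpre hs (cdom ht) = cdom (lih_comp ht hs).
Proof.
apply: cset_ext => x; split=> /=.
  by move=> [y sxy [[y' z] tyz /= yy]]; rewrite -yy in sxy; exists (x, z) => //=; exists y'.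
by move=> [[x' z] /= [y sxy tyz] <-]; exists y => //; exists (y, z).
Qed.

Lemma cpre_comp s t (hs : left_inverse_hull P s) (ht : left_inverse_hull P t) X :
  cpre (lih_comp ht hs) X = cpre hs (cpre ht X).
Proof.
apply: cset_ext => x; split=> /=.
  by move=> [z [y sxy tyz] Xz]; exists y => //; exists z.
by move=> [y sxy [z tyz Xz]]; exists z => //; exists y.
Qed.

Lemma cpreI s (hs : left_inverse_hull P s) X Y :
  cpre hs (csetI X Y) = csetI (cpre hs X) (cpre hs Y).
Proof.
have [inj1 _] := left_inverse_hull_inj hs.
apply: cset_ext => x; split=> /=.
  by move=> [y sxy [Xy Yy]]; split; exists y.
move=> [[y sxy Xy] [z sxz Yz]]; exists y => //; split=> //.
by rewrite (inj1 _ _ _ sxy sxz).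
Qed.

Lemma cpre_full s (hs : left_inverse_hull P s) : cpre hs cfull = cdom hs.
Proof.
apply: cset_ext => x; split=> [[y sxy _]|[[x' y] sxy /= <-]]; first by exists (x, y).
by exists y => //; apply/cfullE; exact: (hull_sub hs sxy).2.
Qed.

Lemma act_Jhat g chi : act_dom g chi -> Jhat (act g chi).
Proof.
move=> [hc [s [hs [sg cs]]]]; have aE X := actE X hc sg cs.
split.
- by exists cfull; rewrite aE cpre_full.
- by move=> X Y; rewrite !aE cpreI; case: hc.
move=> X X0; rewrite aE; case: hc => _ _; apply.
by apply/seteqP; split=> // x [y _ Xy]; have : set0 y by rewrite -X0.
Qed.

Lemma act_mul g h chi : act_dom g chi -> act_dom h (act g chi) ->
  act_dom (h * g) chi /\ act (h * g) chi = act h (act g chi).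
Proof.
move=> dg dh; have hc' := act_Jhat dg.
have [hc [s [hs [sg cs]]]] := dg; have [_ [t [ht [th ct]]]] := dh.
have cts : chi (cdom (lih_comp ht hs)).
  by rewrite -cpre_dom -(actE _ hc sg cs).
have sgh : sigma_eq (t \; s)%relation (h * g).
  have [x [[x' y] xy _]] := Jhat_nonempty hc cts.
  split; first by exists (x', y).
  by move=> [a b] /= [z /sg.2 /= -> /th.2 /= ->]; rewrite mulgA.
split; first by split=> //; exists (t \; s)%relation, (lih_comp ht hs).
apply/funext => X; rewrite (actE _ hc sgh cts) cpre_comp.
by rewrite (actE _ hc' th ct) (actE _ hc sg cs).
Qed.

Lemma act_one chi : Jhat chi -> act_dom 1 chi /\ act 1 chi = chi.
Proof.
move=> hc; have c1 : chi (cdom (lih_mul submonoid1)) := Jhat_full hc.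
have s1 := sigma_eq_mul 1.
split; first by split=> //; exists (mul_graph 1), (lih_mul submonoid1).
apply/funext => X; rewrite (actE _ hc s1 c1); congr (chi _).
apply: cset_ext => x; split=> [[y [/= _ ->]]|Xx]; first by rewrite mul1g.
by exists (1 * x); rewrite ?mul1g //; split=> //=; [exact: cset_sub Xx|rewrite mul1g].
Qed.

Lemma act_inv g chi : act_dom g chi ->
  act_dom g^-1 (act g chi) /\ act g^-1 (act g chi) = chi.
Proof.
move=> dg; have [hc [s [hs [sg cs]]]] := dg.
have dg' : act_dom g^-1 (act g chi).
  split; first exact: act_Jhat.
  exists (s^-1)%relation, (lih_inv hs); split; first exact: sigma_eq_inv.
  rewrite (actE _ hc sg cs) cpre_dom.
  rewrite (_ : cdom _ = cdom hs) //; apply: cset_ext => x; split=> /=.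
    by move=> [[x' z] /= [y sxy _] <-]; exists (x', y).
  by move=> [[x' y] sxy /= <-]; exists (x', x') => //=; exists y.
split=> //; have [_ <-] := act_mul dg dg'; rewrite mulVg.
by have [] := act_one hc.
Qed.

(** Multiplication by [p] has domain P, where every character is 1. Elements of P, unlike general
    group elements, therefore act everywhere. *)
Lemma act_dom_mul p chi : P p -> Jhat chi -> act_dom p chi.
Proof.
move=> Pp hc; split=> //; exists (mul_graph p), (lih_mul Pp).
split; first exact: sigma_eq_mul.
apply: Jhat_mono (Jhat_full hc) => // x /cfullE Px.
by exists (x, p * x).
Qed.

Lemma act_mul_principal p chi (Pp : P p) : Jhat chi -> act p chi (principal Pp).
Proof.
move=> hc; have h : chi (cdom (lih_mul Pp)).
  apply: Jhat_mono (Jhat_full hc) => // x /cfullE Px.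
  by exists (x, p * x).
rewrite (actE _ hc (sigma_eq_mul p) h); apply: Jhat_mono h => //.
move=> x [[x' y] [/= Px _] /= <-]; exists (p * x') => //.
exact: (proj2 (principalE Pp (p * x')) (ex_intro2 _ _ x' Px erefl)).
Qed.

Lemma act_dom_inv p chi (Pp : P p) : Jhat chi -> chi (principal Pp) ->
  act_dom p^-1 chi.
Proof.
move=> hc cp; split=> //; exists (mul_graph p)^-1%relation, (lih_inv (lih_mul Pp)).
by split=> //; apply: sigma_eq_inv; exact: sigma_eq_mul.
Qed.

Lemma act_dom_meet g chi : act_dom g chi -> exists2 x, P x & P (g * x).
Proof.
move=> [hc [s [hs [sg cs]]]]; have [x [[x' y] sxy _]] := Jhat_nonempty hc cs.
have [Px Py] := hull_sub hs sxy; exists x' => //.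
by have /= <- := sg.2 _ sxy.
Qed.

Lemma Omega_max_separate psi Y : Omega_max psi -> psi Y = false ->
  exists2 Z, psi Z & forall x, set_val Z x -> ~ set_val Y x.
Proof.
move=> [hpsi maxpsi] pY; apply: contrapT => /forall2NP h.
(* The filter generated by [psi] and [Y]. If every member of [psi] met [Y], it would be proper, and
   maximality of [psi] would force [psi Y]. *)
pose phi : charJ P := fun V =>
  `[< exists2 Z, psi Z & set_val (csetI Z Y) `<=` set_val V >].
suff hphi : Jhat phi.
  have e : [set X | phi X] = [set X | psi X].
    apply: maxpsi => // X pX; apply/asboolP; exists X => //.
    by move=> x [].
  suff : psi Y by rewrite pY.
  have : [set X | phi X] Y.
    by apply/asboolP; exists cfull; [exact: Jhat_full|move=> x []].
  by rewrite e.
split.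
- by exists cfull; apply/asboolP; exists cfull;
    [exact: Jhat_full|move=> x [/cfullE Px _]; exact/cfullE].
- move=> U V; apply/asboolP/andP => [[Z pZ ZUV]|].
    by split; apply/asboolP; exists Z => // x /ZUV [].
  move=> [/asboolP [Z pZ ZU] /asboolP [Z' pZ' ZV]].
  exists (csetI Z Z'); first exact: JhatI.
  by move=> x /= [[Zx Z'x] Yx]; split; [apply: ZU|apply: ZV].
move=> V V0; apply/asboolP => -[Z pZ]; rewrite V0 => ZV.
have [//|] := h Z; apply=> x Zx Yx; exact: (ZV x).
Qed.

Lemma Omega_maxP psi : Jhat psi ->
  (forall phi : charJ P, Jhat phi -> (forall X, psi X -> phi X) ->
     forall X, phi X -> psi X) -> Omega_max psi.
Proof.
move=> hpsi h; split=> // phi hphi sub; apply/seteqP; split=> X; last exact: sub.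
by apply: h => // Y; exact: sub.
Qed.

Lemma Omega_max_maximal psi phi X : Omega_max psi -> Jhat phi ->
  (forall X, psi X -> phi X) -> phi X -> psi X.
Proof.
move=> [_ h] hphi sub pX; have /seteqP[+ _] := h _ hphi sub.
by apply.
Qed.

(** A character above g.psi still lies in the domain of g^-1, as this condition is monotone; pulled
    back, it is a character above [psi], hence equal to it. *)
Lemma act_Omega_max g psi : Omega_max psi -> act_dom g psi -> Omega_max (act g psi).
Proof.
move=> mpsi dg; have hpsi := mpsi.1; have hg := act_Jhat dg.
have [dg' gK] := act_inv dg.
apply: Omega_maxP => // phi hphi sub X pX.
have dphi : act_dom g^-1 phi.
  have [_ [s [hs [sg cs]]]] := dg'; split=> //; exists s, hs; split=> //.
  exact: sub.
have sub' Y : psi Y -> act g^-1 phi Y.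
  have [_ [s [hs [sg cs]]]] := dg'.
  by rewrite -{1}gK (actE _ hg sg cs) (actE _ hphi sg (sub _ cs)) => /sub.
have e : psi = act g^-1 phi.
  apply/funext => Y; apply/idP/idP; first exact: sub'.
  by apply: Omega_max_maximal => //; exact: act_Jhat.
have [_ phiK] := act_inv dphi; rewrite invgK in phiK.
by rewrite e phiK.
Qed.

Lemma Omega_max_extend chi : Jhat chi ->
  exists2 psi, Omega_max psi & forall X, chi X -> psi X.
Proof.
move=> hc; pose isfilter (A : set (cset P)) : Prop :=
  (forall X Y, A (csetI X Y) <-> A X /\ A Y) /\ (forall X, set_val X = set0 -> ~ A X).
(* [Zorn_bigcup] also ranges over the empty chain, so [chi] is added to [A] here. *)
pose Q (A : set (cset P)) := isfilter (A `|` [set X | chi X]).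
have isfilterJ (A : set (cset P)) : isfilter A -> A cfull ->
    Jhat (fun X => `[< A X >] : bool).
  move=> [AI A0] Af; split.
  - by exists cfull; apply/asboolP.
  - move=> X Y; apply/asboolP/andP => [/AI [? ?]|[/asboolP ? /asboolP ?]].
      by split; apply/asboolP.
    exact/AI.
  - by move=> X X0; apply/asboolP; exact: A0.
have Jfilter (phi : charJ P) : Jhat phi -> isfilter [set X | phi X].
  move=> [_ phiI phi0]; split=> [X Y|X X0] /=; last by rewrite phi0.
  by rewrite phiI; split=> /andP.
have chain (F : set (set (cset P))) : F `<=` Q -> total_on F subset ->
    Q (\bigcup_(A in F) A).
  move=> FQ totF; split=> [X Y|X X0].
    split=> [[[A FA AX]|/(Jfilter _ hc).1 [cX cY]]|].
    - have /(FQ _ FA).1 [] : (A `|` [set X | chi X]) (csetI X Y) by left.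
      by case=> [?|?] [?|?]; split; by [left; exists A|right].
    - by split; right.
    move=> [[[A FA AX]|cX] [[B FB BY]|cY]].
    - have [D FD [DX DY]] : exists2 D, F D & D X /\ D Y.
        case: (totF _ _ FA FB) => [AB|BA]; [exists B|exists A] => //; split=> //.
          exact: AB.
        exact: BA.
      have /(FQ _ FD).1 [?|?] : (D `|` [set X | chi X]) X /\
          (D `|` [set X | chi X]) Y by split; left.
        by left; exists D.
      by right.
    - have /(FQ _ FA).1 [?|?] : (A `|` [set X | chi X]) X /\
          (A `|` [set X | chi X]) Y by split; [left|right].
        by left; exists A.
      by right.
    - have /(FQ _ FB).1 [?|?] : (B `|` [set X | chi X]) X /\
          (B `|` [set X | chi X]) Y by split; [right|left].
        by left; exists B.
      by right.
    - by right; apply/(Jfilter _ hc).1.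
  move=> [[A FA AX]|cX]; first by apply: (FQ _ FA).2 X0 _; left.
  exact: (Jfilter _ hc).2 X0 cX.
have [A [QA maxA]] := Zorn_bigcup chain.
pose psi : charJ P := fun X => `[< (A `|` [set X | chi X]) X >].
have sub X : chi X -> psi X by move=> cX; apply/asboolP; right.
have hpsi : Jhat psi by apply: isfilterJ => //; right; exact: Jhat_full.
exists psi => //; apply: Omega_maxP => // phi hphi psub X pX.
apply: contrapT => npX.
have QB : Q [set X | phi X].
  rewrite /Q (_ : _ `|` _ = [set X | phi X]); first exact: Jfilter.
  by apply/seteqP; split=> Y; [case=> // cY; exact/psub/sub|left].
apply: (maxA [set X | phi X]) QB; split.
  by move=> Y AY; apply: psub; apply/asboolP; left.
by move=> /(_ X pX) AX; apply: npX; apply/asboolP; left.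
Qed.

End Characters.

(** * Neighbourhoods in the boundary and topological freeness *)

Section BoundaryTopology.
Local Open Scope group_scope.
Variables (G : groupType) (P : set G).
Hypothesis hP : monoid_closed (mem P).
Implicit Types (chi psi : charJ P) (X Y Z : cset P) (s t : set (G * G)) (g h k p q : G)
  (L : seq (cset P)) (O : set (charJ P)).

Definition agree_on L chi : set (charJ P) :=
  [set psi | forall X, X \in L -> psi X = chi X].

Lemma agree_on_cat L1 L2 chi psi : agree_on (L1 ++ L2) chi psi <->
  agree_on L1 chi psi /\ agree_on L2 chi psi.
Proof.
split=> [h|[h1 h2] X]; last by rewrite mem_cat => /orP[/h1|/h2].
by split=> X XL; apply: h; rewrite mem_cat XL ?orbT.
Qed.

Lemma nbhs_eval chi X : nbhs chi [set psi : charJ P | psi X = chi X].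
Proof.
have : nbhs (chi X) [set chi X] by exact: discrete_set1.
by move=> /(@proj_continuous _ (fun _ : cset P => bool) X chi).
Qed.

Lemma nbhs_agree_on L chi : nbhs chi (agree_on L chi).
Proof.
elim: L => [|X L IH]; first by apply: filterS filterT => psi _ X.
apply: filterS (filterI (nbhs_eval chi X) IH) => psi /= [pX pL] Y.
by rewrite inE => /orP[/eqP ->|/pL].
Qed.

(** The topology is the supremum of those induced by the evaluations, so it suffices that the filter
    generated by the sets [agree_on L chi] converges for each evaluation. *)
Lemma nbhs_agree_onP chi O : nbhs chi O -> exists L, agree_on L chi `<=` O.
Proof.
pose F : set_system (charJ P) := filter_from setT (fun L => agree_on L chi).
have FF : Filter F.
  apply: filter_from_filter; first by exists [::].
  by move=> L1 L2 _ _; exists (L1 ++ L2) => // psi /agree_on_cat.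
suff : F --> chi by move=> h /h [L _ ?]; exists L.
apply/cvg_sup => X; rewrite cvg_image; last first.
  by rewrite eqEsubset; split=> b // _; exists (fun _ => b).
move=> U /principal_filterP UX.
exists [set psi : charJ P | U (psi X)].
  by exists [:: X] => // psi /(_ X); rewrite inE eqxx => /(_ isT) /= ->.
apply/seteqP; split=> [b [psi Upsi <-] //|b Ub].
by exists (fun _ => b).
Qed.

Lemma boundary_Jhat chi : boundary chi -> Jhat chi.
Proof. by case. Qed.

Lemma boundary_agree chi L : boundary chi ->
  exists2 psi, Omega_max psi & agree_on L chi psi.
Proof. by move=> [_ /(_ _ (nbhs_agree_on L chi))] [psi [? ?]]; exists psi. Qed.

Lemma Omega_max_boundary chi : Omega_max chi -> boundary chi.
Proof. by move=> mc; split; [exact: mc.1|exact: subset_closure]. Qed.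

Lemma boundary_agreeP chi : Jhat chi ->
  (forall L, exists2 psi, Omega_max psi & agree_on L chi psi) -> boundary chi.
Proof.
move=> hc h; split=> // O /nbhs_agree_onP [L LO]; have [psi mp ap] := h L.
by exists psi; split=> //; exact: LO.
Qed.

Lemma act_boundary g chi : act_dom g chi -> boundary chi -> boundary (act g chi).
Proof.
move=> dg bc; apply: boundary_agreeP => [|L]; first exact: act_Jhat.
have [hc [s [hs [sg cs]]]] := dg.
have [psi mp ap] := boundary_agree (cdom hs :: map (cpre hs) L) bc.
have ps : psi (cdom hs) by rewrite ap ?inE ?eqxx.
have dp : act_dom g psi by split; [exact: mp.1|exists s, hs].
exists (act g psi); first exact: act_Omega_max.
move=> X XL; rewrite (actE _ mp.1 sg ps) (actE _ hc sg cs) ap //.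
by rewrite inE map_f ?orbT.
Qed.

Lemma boundary_nbhs chi X O : boundary chi -> nbhs chi O -> chi X ->
  exists p, exists Pp : P p, set_val X p /\
    forall psi, Jhat psi -> psi (principal Pp) -> O psi.
Proof.
move=> bc /nbhs_agree_onP [L LO] cX.
have [psi mp ap] := boundary_agree (X :: L) bc.
have hp := mp.1.
have pX : psi X by rewrite ap ?inE ?eqxx.
(* [Z] decides all of [L]: each [Y] in [L] either contains or misses it. Hence for any p in [Z], a
   character that is 1 at pP agrees with [psi] on [L]. Keeping [Z] inside [X] places p in a
   prescribed domain. *)
have [Z pZ [ZX ZL]] : exists2 Z, psi Z & set_val Z `<=` set_val X /\
    forall Y, Y \in L -> if psi Y then set_val Z `<=` set_val Y
       else forall x, set_val Z x -> ~ set_val Y x.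
  elim: {ap LO} L => [|Y L [Z pZ [ZX ZL]]].
    by exists X => //; split=> [x|Y] //; rewrite in_nil.
  have [W pW hW] : exists2 W, psi W & if psi Y then set_val W `<=` set_val Y
       else forall x, set_val W x -> ~ set_val Y x.
    case pY : (psi Y); first by exists Y.
    exact: (Omega_max_separate hP).
  exists (csetI Z W); first exact: JhatI.
  split=> [x [/ZX] //|V]; rewrite inE => /orP[/eqP ->|/ZL].
    by case: (psi Y) hW => hW x [_ /hW].
  by case: (psi V) => hV x [/hV].
have [p Zp] := Jhat_nonempty hp pZ.
have Pp := cset_sub hP Zp.
exists p, Pp; split=> [|phi hphi phip]; first exact: ZX.
apply: LO => Y YL; rewrite -(ap Y) ?inE ?YL ?orbT //.
have := ZL Y YL; case pY : (psi Y) => ZY.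
  by apply: Jhat_mono phip => //; apply: principal_sub => //; exact: ZY.
apply/negP => phiY.
have [x [/= x1 Yx]] := Jhat_nonempty hphi (JhatI hphi phip phiY).
by apply: ZY Yx; exact: principal_sub x1.
Qed.

(** The constructible sets containing [p] form a proper filter that contains pP; any maximal
    extension will do. *)
Lemma boundary_principal p (Pp : P p) :
  exists2 chi, boundary chi & chi (principal Pp).
Proof.
pose chi : charJ P := fun X => `[< set_val X p >].
have hc : Jhat chi.
  split; first by exists (cfull hP); apply/asboolP/cfullE.
    by move=> X Y; apply/asboolP/andP => [[? ?]|[/asboolP ? /asboolP ?]];
      [split; apply/asboolP|].
  by move=> X X0; apply/asboolP; rewrite X0.
have [psi mp sub] := Omega_max_extend hP hc; exists psi.
  exact: Omega_max_boundary.
by apply: sub; apply/asboolP; exact: principal_mem.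
Qed.

(** The hypothesis is applied to the conjugate p^-1 g p, non-trivial like g: it gives q with qP and
    p^-1 g p q P disjoint, and left multiplication by p yields the claim. *)
Lemma Gc1_disjoint g p : Gc P = [set 1] -> g <> 1 -> P p ->
  exists2 q, P q & forall x y, P x -> P y -> p * q * x <> g * (p * q) * y.
Proof.
move=> Gc1 g1 Pp; have : ~ Gc P (p^-1 * g * p).
  rewrite Gc1 /= => e; apply: g1; have := congr1 (fun z => p * z * p^-1) e.
  by rewrite !mulgA mulgV mul1g mulgK mulg1 mulgV.
move=> /existsNP [q /not_implyP [Pq h]]; exists q => // x y Px Py e.
apply: h; exists (q * x); split; first by exists x.
exists y => //; apply: (mulgI p); rewrite !mulgA in e *.
by rewrite mulgV mul1g e.
Qed.

Lemma Gc1_disjoint_seq (l : seq G) p : Gc P = [set 1] -> 1 \notin l -> P p ->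
  exists2 q, P q & forall g, g \in l ->
    forall x y, P x -> P y -> p * q * x <> g * (p * q) * y.
Proof.
move=> Gc1; elim: l => [|g l IH].
  by move=> _ Pp; exists 1 => //; exact: submonoid1.
rewrite inE negb_or => /andP[g1 l1] Pp.
have [q Pq hq] := IH l1 Pp.
(* Disjointness of pqP from its translates passes to the smaller ideal pqrP, so the group elements
   can be removed one at a time. *)
have [r Pr hr] : exists2 r, P r &
    forall x y, P x -> P y -> p * q * r * x <> g * (p * q * r) * y.
  by apply: Gc1_disjoint => //; [apply/eqP; rewrite eq_sym|exact: submonoidM].
exists (q * r); first exact: submonoidM.
move=> h; rewrite inE => /orP[/eqP ->|hl] x y Px Py; rewrite !mulgA.
  by have := hr x y Px Py; rewrite !mulgA.
have := hq h hl (r * x) (r * y) (submonoidM hP Pr Px) (submonoidM hP Pr Py).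
by rewrite !mulgA.
Qed.

(** If g.psi contained some X outside [psi], some Z in [psi] would miss X, and some p in Z would
    satisfy g p in X. Then pP and gpP meet, in a point of both Z and X. One inclusion suffices, as
    g.psi is maximal too. *)
Lemma Gc_fix_Omega_max g psi : Gc P g -> Omega_max psi -> act_dom g psi ->
  act g psi = psi.
Proof.
move=> gG mp dg; have mg := act_Omega_max hP mp dg.
have sub X : act g psi X -> psi X.
  move=> gX; apply: contrapT => /negP/negbTE pX.
  have [Z pZ hZ] := Omega_max_separate hP mp pX.
  have [hp [s [hs [sg ps]]]] := dg.
  rewrite (actE _ hp sg ps) in gX.
  have [p [Zp [y spy Xy]]] := Jhat_nonempty hp (JhatI hp pZ gX).
  have [_ [[x Px <-] [x' Px' e]]] := gG p (cset_sub hP Zp).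
  apply: (hZ (p * x)); first exact: cset_mulr.
  rewrite -e; have /= <- := sg.2 _ spy; exact: cset_mulr.
apply/funext => X; apply/idP/idP; first exact: sub.
by apply: Omega_max_maximal => //; exact: mp.1.
Qed.

Lemma topologically_freeP : topologically_free P <-> Gc P = [set 1].
Proof.
split=> [tf|Gc1 g g1 chi [dg bc] O nO].
  apply/seteqP; split=> [g gG|_ ->]; last first.
    move=> p Pp; exists (p * 1); split; exists 1 => //; try exact: submonoid1.
    by rewrite mul1g.
  apply: contrapT => g1.
  (* The case p = 1 gives x = g y with x, y in P, so g is defined wherever chi(yP) = 1. Without a
     point in its domain, freeness would say nothing about g. *)
  have [_ [[x Px <-] [y Py e]]] := gG 1 (submonoid1 hP).
  rewrite !mul1g mulg1 in e.
  have [chi bc cy] := boundary_principal Py.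
  have dg : act_dom g chi.
    split; first exact: boundary_Jhat.
    pose s := (mul_graph P x \; (mul_graph P y)^-1)%relation.
    exists s, (lih_comp (lih_mul Px) (lih_inv (lih_mul Py))); split.
      split; first by exists (y, x), 1; split=> //=; rewrite ?mulg1 //; exact: submonoid1.
      by move=> [a b] /= [z [/= Pz ->] [/= _ ->]]; rewrite mulgA -e.
    apply: Jhat_mono cy => //; first exact: boundary_Jhat.
    move=> a /principalE [z Pz ->]; exists (y * z, x * z) => //=.
    by exists z.
  have [chi1 [[[dg1 bc1] gn] _]] := tf g g1 chi (conj dg bc) setT filterT.
  have [X nX] : exists X, act g chi1 X <> chi1 X.
    by apply: contrapT => /forallNP h; apply/gn/funext => X; apply: contrapT.
  have [hc1 [s [hs [sg cs]]]] := dg1.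
  (* These three values decide whether g is defined and the values at [X] before and after acting,
     so a maximal [psi] with the same values would be moved by g. *)
  have [psi mp ap] := boundary_agree [:: cdom hs; X; cpre hs X] bc1.
  have ps : psi (cdom hs) by rewrite ap // !inE eqxx.
  apply: nX; rewrite (actE _ hc1 sg cs).
  have dp : act_dom g psi by split; [exact: mp.1|exists s, hs].
  have := congr1 (fun f : charJ P => f X) (Gc_fix_Omega_max gG mp dp).
  by rewrite (actE _ mp.1 sg ps) !ap // !inE eqxx ?orbT.
have [hc [s [hs [sg cs]]]] := dg.
have [p [Pp [ps hp]]] := boundary_nbhs bc nO cs.
have [q Pq hq] := Gc1_disjoint Gc1 g1 Pp.
have Ppq := submonoidM hP Pp Pq.
have [psi bp pp] := boundary_principal Ppq.
have hpsi := boundary_Jhat bp.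
have psis : psi (cdom hs).
  by apply: Jhat_mono pp => //; apply: principal_sub => //; exact: cset_mulr.
have dp : act_dom g psi by split=> //; exists s, hs.
exists psi; split; last first.
  apply: hp => //; apply: Jhat_mono pp => //; apply: principal_sub => //.
  by apply: cset_mulr => //; exact: principal_mem.
split=> // gpsi.
have : psi (cpre hs (principal Ppq)).
  by rewrite -(actE _ hpsi sg psis) gpsi.
move=> h; have [w [/principalE [x Px ->] h']] := Jhat_nonempty hpsi (JhatI hpsi pp h).
have [v sv /principalE [y Py vE]] :
    exists2 v, s (p * q * x, v) & set_val (principal Ppq) v := h'.
have /= e := sg.2 _ sv; rewrite vE in e.
by apply: (hq y x Py Px); rewrite e -!mulgA.
Qed.

End BoundaryTopology.

(** * The convolution algebra of the boundary groupoid *)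

Section GroupoidFunctions.
Variables (R : realType) (G : groupType) (P : set G).
Hypothesis hP : monoid_closed (mem P).
Local Notation C := R[i].
Local Notation nrm := (@ComplexField.Normc.normc R).
Implicit Types (chi psi : charJ P) (X Y Z : cset P) (s t : set (G * G)) (g h k p q : G)
  (L : seq (cset P)) (O : set (charJ P))
  (f : discrete_topology G * charJ P -> R[i]^o) (phi : charJ P -> R[i]^o).

Definition arrow_dom g : set (charJ P) := act_dom g `&` boundary (P := P).

Definition boundary_continuous phi : Prop := forall chi, boundary chi ->
  phi @ within (boundary (P := P)) (nbhs chi) --> phi chi.

Lemma charJ_hausdorff : hausdorff_space (charJ P).
Proof.
apply: (@hausdorff_product (cset P) (fun _ => bool)) => _.
exact: discrete_hausdorff.
Qed.

Lemma charJ_compact : compact [set: charJ P].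
Proof.
have := @tychonoff (cset P) (fun _ => bool) (fun _ => setT) (fun _ => bool_compact).
by congr compact; apply/seteqP.
Qed.

(** A pointwise limit of characters cannot be zero, because all characters are 1 at [cfull]. The
    other conditions each involve finitely many values. *)
Lemma boundary_closed : closed (boundary (P := P)).
Proof.
move=> chi cl.
have ag L : exists2 psi, boundary psi & agree_on L chi psi.
  by have [psi [? ?]] := cl _ (nbhs_agree_on L chi); exists psi.
apply: boundary_agreeP => [|L]; last first.
  have [psi bp ap] := ag L; have [psi' mp ap'] := boundary_agree L bp.
  by exists psi' => // X XL; rewrite ap' ?ap.
split.
- have [psi [hp _] ap] := ag [:: cfull hP]; exists (cfull hP).
  by rewrite -ap ?inE ?eqxx //; exact: Jhat_full.
- move=> X Y; have [psi [[_ hp _] _] ap] := ag [:: X; Y; csetI X Y].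
  by rewrite -!ap ?inE ?eqxx ?orbT.
move=> X X0; have [psi [[_ _ hp] _] ap] := ag [:: X].
by rewrite -ap ?inE ?eqxx // hp.
Qed.

Lemma boundary_cylinder_compact X : compact [set chi : charJ P | boundary chi /\ chi X].
Proof.
apply: subclosed_compact charJ_compact _ => //.
apply: (@closedI _ (boundary (P := P)) [set chi : charJ P | chi X]).
  exact: boundary_closed.
move=> chi cl; have [psi [/= pX e]] := cl _ (nbhs_eval chi X).
by rewrite /= -e.
Qed.

Lemma arrow_dom_boundary g chi : arrow_dom g chi -> boundary chi.
Proof. by case. Qed.

Lemma arrow_dom_nbhs g chi : arrow_dom g chi ->
  \forall psi \near within (boundary (P := P)) (nbhs chi), arrow_dom g psi.
Proof.
move=> [[hc [s [hs [sg cs]]]] bc]; rewrite near_withinE.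
apply: filterS (nbhs_eval chi (cdom hs)) => psi /= e bp; split=> //.
by split; [exact: boundary_Jhat|exists s, hs; rewrite e].
Qed.

Lemma act_cvg g chi : arrow_dom g chi ->
  act g @ within (boundary (P := P)) (nbhs chi) -->
    within (boundary (P := P)) (nbhs (act g chi)).
Proof.
move=> dg; have [[hc [s [hs [sg cs]]]] bc] := dg.
move=> U; rewrite /within /= => /nbhs_agree_onP [L LU].
have := nbhs_agree_on (cdom hs :: map (cpre hs) L) chi.
rewrite /fmap /=; apply: filterS => psi ap bp.
have ps : psi (cdom hs) by rewrite ap ?inE ?eqxx.
have hpsi := boundary_Jhat bp.
have dp : act_dom g psi by split=> //; exists s, hs.
apply: LU; last exact: act_boundary.
move=> X XL; rewrite (actE _ hpsi sg ps) (actE _ hc sg cs) ap //.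
by rewrite inE map_f ?orbT.
Qed.

Lemma arrow_domM g h chi : arrow_dom g chi -> arrow_dom h (act g chi) ->
  arrow_dom (h * g)%g chi /\ act (h * g)%g chi = act h (act g chi).
Proof. by move=> [dg bc] [dh _]; have [? ?] := act_mul hP dg dh. Qed.

(** As G is discrete, a compact set of arrows meets finitely many slices. On a slice, compact
    support inside the relatively open domain of g makes the extension by 0 continuous on the whole
    boundary. Later arguments thus avoid the subspace topology of the groupoid. *)
Lemma groupoid_CcP f : groupoid_Cc f <->
  (exists F : {fset G}, forall g chi, g \notin F -> f (g, chi) = 0) /\
  forall g, boundary_continuous (fun chi => f (g, chi)) /\
    exists K, [/\ compact K, K `<=` arrow_dom g &
                  forall chi, ~ K chi -> f (g, chi) = 0].
Proof.
split=> [[cf [K [cK sK K0]]]|[[F hF] hf]].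
  split.
    have /compact_near_coveringP cov := cK.
    have [|F _ FK] := cov {fset G} showcase.summability.totally
        (fun F a => a.1 \in F) (showcase.summability.totally_filter).
      move=> [g chi] _; exists ([set a : discrete_topology G * charJ P | a.1 = g],
          [set F | [fset g] `<=` F]%fset) => /=.
        split; last by exists [fset g]%fset.
        exists ([set g], setT); last by move=> [? ?] [].
        by split; [exact: discrete_set1|exact: filterT].
      by move=> [a F] /= [->]; rewrite fsub1set.
    exists F => g chi gF; apply: K0 => /(FK F (fsubset_refl F)) /=.
    by rewrite (negbTE gF).
  move=> g; pose Kg := [set chi : charJ P | K (g, chi)].
  have cKg : compact Kg.
    have -> : Kg = snd @` (K `&` [set a | a.1 = g]).
      apply/seteqP; split=> [chi Kc|_ [[g' chi] [Kc /= e] <-]]; first by exists (g, chi).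
      by rewrite /Kg /= -e.
    apply: continuous_compact.
      by apply: continuous_subspaceT => x; exact: cvg_snd.
    apply: compact_closedI => //.
    move=> [g' chi] cl.
    have [|[a b] [/= e [e1 _]]] := cl ([set g'] `*` setT).
      by exists ([set g'], setT) => //; split; [exact: discrete_set1|exact: filterT].
    by rewrite /= -e1.
  have sKg : Kg `<=` arrow_dom g by move=> chi /sK.
  split; last by exists Kg; split=> // chi; exact: K0.
  move=> chi bc; have [dg|ndg] := pselect (arrow_dom g chi).
    have := proj1 (subspace_continuousP _ _) cf (g, chi) dg.
    move=> h U /h; rewrite /fmap /within /= => -[[A B] /= [nA nB] AB].
    have nB0 : nbhs chi B := nB.
    have nD : nbhs chi [set psi | boundary psi -> arrow_dom g psi] := arrow_dom_nbhs dg.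
    have FF : Filter (nbhs chi) := nbhs_filter chi.
    have nB' := @filterI _ _ FF _ _ nB0 nD.
    suff : nbhs chi [set psi | boundary psi -> U (f (g, psi))] by [].
    apply: (@filterS _ _ FF _ _ _ nB') => psi [Bpsi /[apply] dpsi].
    apply: (AB (g, psi)); last exact: dpsi.
    by split=> //=; exact: nbhs_singleton nA.
  have nK : ~ Kg chi by move=> /sKg.
  have ncl : nbhs chi (~` Kg).
    apply: open_nbhs_nbhs; split=> //; apply: closed_openC.
    exact: compact_closed charJ_hausdorff cKg.
  apply: cvg_near_cst; rewrite near_withinE; apply: filterS ncl => psi nK' _.
  by rewrite (K0 _ nK) (K0 _ nK').
split.
  apply/subspace_continuousP => -[g chi] dg U /((hf g).1 _ (arrow_dom_boundary dg)).
  rewrite /fmap /within /= => h.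
  exists ([set g], [set psi | boundary psi -> U (f (g, psi))]).
    by split=> //; exact: discrete_set1.
  by move=> [g' psi] /= [-> h'] [_ bp]; exact: h'.
have /choice [K hK] g : exists K, [/\ compact K, K `<=` arrow_dom g &
   forall chi, ~ K chi -> f (g, chi) = 0] := (hf g).2.
exists (\big[setU/set0]_(g <- F) ([set g : discrete_topology G] `*` K g)); split.
- apply: bigsetU_compact => g _; apply: compact_setX; first exact: compact_set1.
  by have [] := hK g.
- rewrite -bigcup_seq => -[g' chi] [g _ [/= -> Kc]].
  by have [_ sK _] := hK g; exact: sK.
move=> [g chi] nK; have [gF|/hF //] := boolP (g \in F).
have [_ _ K0] := hK g; apply: K0 => Kc; apply: nK.
by rewrite -bigcup_seq; exists g.
Qed.

Lemma boundary_continuousP phi : boundary_continuous phi <->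
  forall chi, boundary chi -> forall e : R, 0 < e -> exists L,
    forall psi, boundary psi -> agree_on L chi psi -> nrm (phi psi - phi chi) < e.
Proof.
split=> [h chi bc e e0|h chi bc].
  have e0' : (0 : C) < e%:C%C by rewrite ltcR.
  have /cvgrPdist_lt /(_ _ e0') := h chi bc.
  rewrite near_withinE => /nbhs_agree_onP [L LO]; exists L => psi bp ap.
  have := LO psi ap bp; rewrite /= distrC normcE_norm ltcR.
  by [].
apply/cvgrPdist_lt => e /gt0_complex [-> e0].
have [L hL] := h chi bc _ e0; rewrite near_withinE.
apply: filterS (nbhs_agree_on L chi) => psi ap bp.
by rewrite distrC normcE_norm ltcR; exact: hL.
Qed.

End GroupoidFunctions.

(** * Convolution of compactly supported functions *)

Section ConvolutionAlgebra.
Variables (R : realType) (G : groupType) (P : set G).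
Hypothesis hP : monoid_closed (mem P).
Local Notation C := R[i].
Local Notation arr := (arrow P).
Local Notation L2 := (ell2 R arr).
Implicit Types (chi psi : charJ P) (X Y Z : cset P) (s t : set (G * G)) (g h k p q : G)
  (L : seq (cset P)) (O : set (charJ P)) (a b c : arr) (S T : L2 -> L2) (xi : L2)
  (f : discrete_topology G * charJ P -> R[i]^o) (phi : charJ P -> R[i]^o).

Lemma groupoid_Cc0 : groupoid_Cc (fun _ : discrete_topology G * charJ P => 0 : R[i]^o).
Proof.
apply/groupoid_CcP; split; first by exists fset0.
move=> g; split; first by move=> chi _; exact: cvg_cst.
by exists set0; split=> //; exact: compact0.
Qed.

Lemma groupoid_CcD f f' : groupoid_Cc f -> groupoid_Cc f' ->
  groupoid_Cc (fun x => f x + f' x : R[i]^o).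
Proof.
move=> /groupoid_CcP [[F hF] hf] /groupoid_CcP [[F' hF'] hf'].
apply/groupoid_CcP; split.
  exists (F `|` F')%fset => g chi; rewrite inE negb_or => /andP[gF gF'].
  by rewrite hF ?hF' ?addr0.
move=> g; have [cf [K [cK sK K0]]] := hf g; have [cf' [K' [cK' sK' K0']]] := hf' g.
split; first by move=> chi bc; apply: cvgD; [exact: cf|exact: cf'].
exists (K `|` K'); split; first exact: compactU.
  by move=> chi [/sK|/sK'].
by move=> chi /not_orP [/K0 -> /K0' ->]; rewrite addr0.
Qed.

Lemma groupoid_CcZ (z : C) f : groupoid_Cc f ->
  groupoid_Cc (fun x => z * f x : R[i]^o).
Proof.
move=> /groupoid_CcP [[F hF] hf].
apply/groupoid_CcP; split.
  by exists F => g chi gF; rewrite hF ?mulr0.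
move=> g; have [cf [K [cK sK K0]]] := hf g.
split; first by move=> chi bc; apply: cvgM; [exact: cvg_cst|exact: cf].
by exists K; split=> // chi /K0 ->; rewrite mulr0.
Qed.

(** For X inside the domain of g, the indicator function of a compact open bisection. *)
Definition cylinder_bisection g X : discrete_topology G * charJ P -> R[i]^o :=
  fun x => (`[< x.1 = g /\ boundary x.2 /\ x.2 X >])%:R.

Lemma groupoid_Cc_cylinder g X :
    (forall chi, boundary chi -> chi X -> act_dom g chi) ->
  groupoid_Cc (cylinder_bisection g X).
Proof.
move=> gX; apply/groupoid_CcP; split.
  exists [fset (g : G)]%fset => h chi; rewrite inE => hg.
  rewrite /cylinder_bisection; case: asboolP => //= -[e _].
  by rewrite e eqxx in hg.
move=> h; split.
  apply/boundary_continuousP => chi bc e e0; exists [:: X] => psi bp ap.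
  rewrite (_ : cylinder_bisection g X (h, psi) = cylinder_bisection g X (h, chi)).
    by rewrite subrr ComplexField.Normc.normc0.
  rewrite /cylinder_bisection /=; congr (_%:R); congr (nat_of_bool _).
  apply: asbool_equiv_eq; rewrite (ap X) ?inE ?eqxx //.
  by split=> -[? [_ ?]].
have [->|hg] := eqVneq h g; last first.
  exists set0; split=> //; first exact: compact0.
  move=> chi _; rewrite /cylinder_bisection; case: asboolP => //= -[e _].
  by rewrite e eqxx in hg.
exists [set chi : charJ P | boundary chi /\ chi X]; split.
- exact: boundary_cylinder_compact.
- by move=> chi [bc cX]; split=> //; exact: gX.
by move=> chi nX; rewrite /cylinder_bisection; case: asboolP => //= -[_].
Qed.

(** A sum over the factorizations (m, chi) = (m k^-1, k.chi)(k, chi). The test discards those k for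
    which k.chi is not meaningful. *)
Definition groupoid_conv f f' : discrete_topology G * charJ P -> R[i]^o :=
  fun x => \sum_(k \in [set: G])
    (if `[< arrow_dom k x.2 >] then f ((x.1 * k^-1)%g, act k x.2) * f' (k, x.2) else 0).

Lemma groupoid_convE f f' (F' : {fset G}) :
    (forall g chi, g \notin F' -> f' (g, chi) = 0) -> forall m chi,
  groupoid_conv f f' (m, chi) = \sum_(k <- F')
    (if `[< arrow_dom k chi >] then f ((m * k^-1)%g, act k chi) * f' (k, chi) else 0).
Proof.
move=> hF' m chi; apply: fsbigTE => k kF.
by rewrite hF' // mulr0; case: ifP.
Qed.

Lemma boundary_continuous_sum (s : seq G) (F : G -> charJ P -> R[i]^o) :
  (forall k, boundary_continuous (F k)) ->
  boundary_continuous (fun chi => \sum_(k <- s) F k chi).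
Proof.
move=> hF; elim: s => [|k s IH].
  have -> : (fun chi => \sum_(k <- [::]) F k chi) = (fun=> 0).
    by apply/funext => chi; rewrite big_nil.
  by move=> chi _; exact: cvg_cst.
have -> : (fun chi => \sum_(k0 <- k :: s) F k0 chi) =
    (fun chi => F k chi + \sum_(k0 <- s) F k0 chi).
  by apply/funext => chi; rewrite big_cons.
by move=> chi bc; apply: cvgD; [exact: hF|exact: IH].
Qed.

Lemma groupoid_Cc_conv f f' : groupoid_Cc f -> groupoid_Cc f' ->
  groupoid_Cc (groupoid_conv f f').
Proof.
move=> /groupoid_CcP [[F hF] hf] /groupoid_CcP [[F' hF'] hf'].
apply/groupoid_CcP; split.
  exists [fset (h * k)%g | h in F, k in F']%fset => m chi mN.
  rewrite (groupoid_convE _ hF') big_seq big1 // => k kF'; case: ifP => // _.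
  rewrite hF ?mul0r //; apply: contra mN => mkF; apply/imfset2P => /=.
  by exists (m * k^-1)%g => //; exists k => //; rewrite divgK.
move=> m.
have /choice [K hK] g : exists K, [/\ compact K, K `<=` arrow_dom g &
   forall chi, ~ K chi -> f (g, chi) = 0] := (hf g).2.
have /choice [K' hK'] g : exists K, [/\ compact K, K `<=` arrow_dom g &
   forall chi, ~ K chi -> f' (g, chi) = 0] := (hf' g).2.
have clK g : closed (K g).
  by have [cK _ _] := hK g; exact: compact_closed (@charJ_hausdorff _ _) cK.
have clK' g : closed (K' g).
  by have [cK _ _] := hK' g; exact: compact_closed (@charJ_hausdorff _ _) cK.
split.
  have -> : (fun chi => groupoid_conv f f' (m, chi)) = (fun chi => \sum_(k <- F')
    (if `[< arrow_dom k chi >] then f ((m * k^-1)%g, act k chi) * f' (k, chi) else 0)).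
    by apply/funext => chi; exact: groupoid_convE.
  apply: boundary_continuous_sum => k chi bc.
  have [dk|ndk] := pselect (arrow_dom k chi).
    rewrite (asboolT dk).
    apply: (@cvg_trans _ ((fun psi => f ((m * k^-1)%g, act k psi) * f' (k, psi)) @
       within (boundary (P:=P)) (nbhs chi))).
      apply: near_eq_cvg; apply: filterS (arrow_dom_nbhs dk) => psi dp.
      by rewrite (asboolT dp).
    apply: cvgM; last exact: (hf' k).1.
    apply: cvg_trans ((hf (m * k^-1)%g).1 (act k chi) _).
      move=> U /= /(act_cvg hP dk).
      by [].
    by apply: act_boundary; case: dk.
  (* Off the domain of [k] the cut-off term could jump; it does not, since [f'] vanishes on the open
     complement of [K' k]. *)
  have nK : ~ K' k chi by have [_ sK _] := hK' k; move=> /sK.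
  rewrite asboolF //; apply: cvg_near_cst; rewrite near_withinE.
  have ncl : nbhs chi (~` K' k).
    by apply: open_nbhs_nbhs; split=> //; exact: closed_openC.
  have FF : Filter (nbhs chi) := nbhs_filter chi.
  apply: (@filterS _ _ FF _ _ _ ncl) => psi nK' _.
  by have [_ _ K0] := hK' k; rewrite K0 // mulr0; case: ifP.
(* The set attached to [k] is closed in the compact set [K' k], on which [act k] is continuous. *)
exists (\big[setU/set0]_(k <- F') [set chi | K' k chi /\ K (m * k^-1)%g (act k chi)]).
split.
- apply: bigsetU_compact => k _.
  have [cK sK _] := hK' k; apply: subclosed_compact cK _; last by move=> chi [].
  move=> chi cl.
  have Kc : K' k chi.
    by apply: clK' => U nU; have [psi [[? _] ?]] := cl U nU; exists psi.
  split=> //; apply: clK => U nU.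
  have : within (boundary (P:=P)) (nbhs (act k chi)) U.
    have FF : Filter (nbhs (act k chi)) := nbhs_filter (act k chi).
    by apply: (@filterS _ _ FF _ _ _ nU) => psi ? _.
  move=> /(act_cvg hP (sK _ Kc)) h.
  have h' : nbhs chi [set psi | boundary psi -> U (act k psi)] := h.
  have [psi [[K1 K2] hU]] := cl _ h'.
  by exists (act k psi); split=> //; apply: hU; case: (sK _ K1).
- rewrite -bigcup_seq => chi [k _ /= [/(fun x => (let: And3 _ sK _ := hK' k in sK) _ x) d1]].
  have [_ sK _] := hK (m * k^-1)%g; move=> /sK d2.
  by have [] := arrow_domM hP d1 d2; rewrite divgK.
move=> chi nK; rewrite (groupoid_convE _ hF') big_seq big1 // => k kF.
case: ifP => // _.
have [_ _ K0] := hK (m * k^-1)%g; have [_ _ K0'] := hK' k.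
have [K1|/K0' ->] := pselect (K' k chi); last by rewrite mulr0.
have [K2|/K0 ->] := pselect (K (m * k^-1)%g (act k chi)); last by rewrite mul0r.
by case: nK; rewrite -bigcup_seq; exists k.
Qed.

End ConvolutionAlgebra.

(** * Arrows, convolution operators and translations *)

Section BoundaryOperators.
Variables (R : realType) (G : groupType) (P : set G).
Hypothesis hP : monoid_closed (mem P).
Local Notation C := R[i].
Local Notation arr := (arrow P).
Local Notation L2 := (ell2 R arr).
Implicit Types (chi psi : charJ P) (X Y Z : cset P) (s t : set (G * G)) (g h k p q : G)
  (L : seq (cset P)) (O : set (charJ P)) (a b c : arr) (S T : L2 -> L2) (xi : L2)
  (f : discrete_topology G * charJ P -> R[i]^o) (phi : charJ P -> R[i]^o).

Definition arr_grp a : G := (set_val a).1.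
Definition arr_src a : charJ P := (set_val a).2.
Definition arr_tgt a : charJ P := act (arr_grp a) (arr_src a).

Lemma arr_dom a : arrow_dom (arr_grp a) (arr_src a).
Proof. exact: (set_valP a). Qed.

Lemma arr_ext a b : arr_grp a = arr_grp b -> arr_src a = arr_src b -> a = b.
Proof.
move=> h1 h2; apply: val_inj; rewrite -[LHS]/(set_val a) -[RHS]/(set_val b).
by rewrite (surjective_pairing (set_val a)) (surjective_pairing (set_val b)); congr pair.
Qed.

Definition mk_arr g chi (d : arrow_dom g chi) : arr :=
  SigSub (mem_set (d : boundary_groupoid P (g, chi))).

Lemma arr_tgt_boundary a : boundary (arr_tgt a).
Proof. by have [? ?] := arr_dom a; exact: act_boundary. Qed.

(** Left multiplication of [a] by the arrow over g that starts at its target. The test concerns the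
    product at the source of [a]; [arr_shift_tgt] and [arr_shift_dom] show that it amounts to g
    being defined at the target. *)
Definition arr_shift g a : option arr :=
  match pselect (arrow_dom (g * arr_grp a)%g (arr_src a)) with
  | left d => Some (mk_arr d)
  | right _ => None
  end.

Lemma arr_shiftP g a b : arr_shift g a = Some b <->
  arr_grp b = (g * arr_grp a)%g /\ arr_src b = arr_src a.
Proof.
rewrite /arr_shift; case: pselect => [d|nd]; split=> //.
- by move=> [<-].
- by move=> [h1 h2]; congr Some; apply: arr_ext.
by move=> [h1 h2]; case: nd; rewrite -h1 -h2; exact: arr_dom.
Qed.

Lemma arr_shift_some g a : arrow_dom (g * arr_grp a)%g (arr_src a) ->
  exists b, arr_shift g a = Some b.
Proof. by rewrite /arr_shift; case: pselect => // d _; exists (mk_arr d). Qed.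

Lemma arr_shift_sym g a b : arr_shift g a = Some b <-> arr_shift g^-1%g b = Some a.
Proof.
split=> /arr_shiftP [h1 h2]; apply/arr_shiftP; rewrite h1 h2; split=> //.
  by rewrite mulKg.
by rewrite mulVKg.
Qed.

Lemma arr_shift_symV g a b : arr_shift g^-1%g a = Some b <-> arr_shift g b = Some a.
Proof. by rewrite arr_shift_sym invgK. Qed.

Lemma arr_shift_tgt g a b : arr_shift g a = Some b ->
  arrow_dom g (arr_tgt a) /\ arr_tgt b = act g (arr_tgt a).
Proof.
move=> /arr_shiftP [h1 h2].
have [da bs] := arr_dom a; have [da' aK] := act_inv hP da.
have [db _] := arr_dom b.
have e : (arr_grp b * (arr_grp a)^-1 = g)%g by rewrite h1 mulgK.
have db' : act_dom (arr_grp b) (act (arr_grp a)^-1%g (arr_tgt a)).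
  by rewrite /arr_tgt aK -h2.
have [d1 d2] := act_mul hP da' db'.
rewrite e in d1 d2; split; first by split=> //; exact: arr_tgt_boundary.
by rewrite d2 /arr_tgt aK h2.
Qed.

Lemma arr_shift_dom g a : arrow_dom g (arr_tgt a) -> exists b, arr_shift g a = Some b.
Proof.
move=> d; apply: arr_shift_some.
by have [] := arrow_domM hP (arr_dom a) d.
Qed.

Lemma arr_shift_mul p a : P p -> exists b, arr_shift p a = Some b.
Proof.
move=> Pp; apply: arr_shift_dom; split; last exact: arr_tgt_boundary.
by apply: act_dom_mul => //; exact/boundary_Jhat/arr_tgt_boundary.
Qed.

(** The convolution sum is reindexed by the group component h of c b^-1. The index set no longer
    depends on c, and finite support of [f] in G makes the sum finite. *)
Definition conv_term f xi c h : C :=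
  oapp (fun b => f (h, arr_tgt b) * xi b) 0 (arr_shift h^-1%g c).

Lemma convolution_sumE f xi c :
  \sum_(b \in [set b : arrow P | (set_val b).2 = (set_val c).2])
      f (((set_val c).1 * (set_val b).1^-1)%g,
         act (set_val b).1 (set_val b).2) * xi b =
  \sum_(h \in [set: G]) conv_term f xi c h.
Proof.
set fib := [set b : arr | _].
pose F b : G := (arr_grp c * (arr_grp b)^-1)%g.
have injF : set_inj fib F.
  move=> a b /set_mem fa /set_mem fb /mulgI /invg_inj e; apply: arr_ext => //.
  by rewrite /arr_src fa fb.
have sF b : fib b -> arr_shift (F b)^-1%g c = Some b.
  move=> fb; apply/arr_shiftP; split=> //.
  by rewrite /F invgM invgK divgK.
rewrite -(@fsbig_widen _ _ _ _ (F @` fib) [set: G]) //; last first.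
  move=> h [_ nF]; rewrite /= /conv_term.
  case e : (arr_shift _ _) => [b|] //=; case: nF.
  move/arr_shiftP : e => [e1 e2]; exists b => //.
  by rewrite /F e1 invgM invgK mulVKg.
rewrite fsbig_image //; apply: eq_fsbigr => b /set_mem fb.
by rewrite /conv_term sF.
Qed.

Lemma convolution_opE f T : convolution_op f T <->
  forall xi c, T xi c = \sum_(h \in [set: G]) conv_term f xi c h.
Proof.
by split=> h xi c; rewrite h convolution_sumE.
Qed.

Lemma conv_term_sum f xi c (F : {fset G}) :
    (forall g chi, g \notin F -> f (g, chi) = 0) ->
  \sum_(h \in [set: G]) conv_term f xi c h = \sum_(h <- F) conv_term f xi c h.
Proof.
move=> hF; apply: fsbigTE => h hN; rewrite /conv_term.
by case: arr_shift => //= b; rewrite hF // mul0r.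
Qed.

Lemma groupoid_Cc_support f : groupoid_Cc f ->
  exists F : {fset G}, forall g chi, g \notin F -> f (g, chi) = 0.
Proof. by move=> /groupoid_CcP []. Qed.

Lemma convolution_op0 : convolution_op (fun _ => 0 : R[i]^o) (0 : L2 -> L2).
Proof.
apply/convolution_opE => xi c; rewrite fsbig1 // => h _.
by rewrite /conv_term; case: arr_shift => //= b; rewrite mul0r.
Qed.

Lemma convolution_opD f f' S T : groupoid_Cc f -> groupoid_Cc f' ->
  convolution_op f S -> convolution_op f' T ->
  convolution_op (fun x => f x + f' x : R[i]^o) (S + T).
Proof.
move=> /groupoid_Cc_support [F hF] /groupoid_Cc_support [F' hF'].
move=> /convolution_opE hS /convolution_opE hT; apply/convolution_opE => xi c.
rewrite -[LHS]/(S xi c + T xi c) hS hT.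
have h1 g chi : g \notin (F `|` F')%fset -> f (g, chi) = 0.
  by rewrite inE negb_or => /andP[gF _]; exact: hF.
have h2 g chi : g \notin (F `|` F')%fset -> f' (g, chi) = 0.
  by rewrite inE negb_or => /andP[_ gF]; exact: hF'.
rewrite (conv_term_sum _ _ h1) (conv_term_sum _ _ h2).
rewrite (@conv_term_sum _ xi c (F `|` F')%fset); last by move=> g chi gF; rewrite h1 ?h2 ?addr0.
rewrite -big_split /=; apply: eq_bigr => h _; rewrite /conv_term.
by case: arr_shift => [b|] /=; rewrite ?addr0 // mulrDl.
Qed.

Lemma convolution_opZ (z : C) f S : groupoid_Cc f -> convolution_op f S ->
  convolution_op (fun x => z * f x : R[i]^o) (z *: S).
Proof.
move=> /groupoid_Cc_support [F hF].
move=> /convolution_opE hS; apply/convolution_opE => xi c.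
rewrite -[LHS]/(z * S xi c) hS (conv_term_sum _ _ hF).
rewrite (@conv_term_sum _ xi c F); last by move=> g chi gF; rewrite hF ?mulr0.
rewrite mulr_sumr; apply: eq_bigr => h _; rewrite /conv_term.
by case: arr_shift => [b|] /=; rewrite ?mulr0 // mulrA.
Qed.

Lemma convolution_op_comp f f' S T : groupoid_Cc f -> groupoid_Cc f' ->
  convolution_op f S -> convolution_op f' T ->
  convolution_op (groupoid_conv f f') (S \o T).
Proof.
move=> /groupoid_Cc_support [F hF] /groupoid_Cc_support [F' hF'].
move=> /convolution_opE hS /convolution_opE hT; apply/convolution_opE => xi c.
rewrite -[LHS]/(S (T xi) c) hS (conv_term_sum _ _ hF).
(* The contribution of the factorization c = h.(k.a). One side sums it over the pairs (h, k), the
   other over k and the product m = h k. *)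
pose t h k : C := oapp (fun b => oapp (fun a =>
  f (h, arr_tgt b) * (f' (k, arr_tgt a) * xi a)) 0 (arr_shift k^-1%g b)) 0
  (arr_shift h^-1%g c).
have E1 h : conv_term f (T xi) c h = \sum_(k <- F') t h k.
  rewrite /conv_term /t; case: arr_shift => [b|] /=; last by rewrite big1.
  rewrite hT (conv_term_sum _ _ hF') mulr_sumr; apply: eq_bigr => k _.
  by rewrite /conv_term; case: arr_shift => [a|] /=; rewrite ?mulr0.
under eq_bigr do rewrite E1.
pose M := [fset (h * k)%g | h in F, k in F']%fset.
have hM m chi : m \notin M -> groupoid_conv f f' (m, chi) = 0.
  move=> mN; rewrite (groupoid_convE _ hF') big_seq big1 // => k kF'.
  case: ifP => // _; rewrite hF ?mul0r //.
  apply: contra mN => mkF; apply/imfset2P => /=.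
  by exists (m * k^-1)%g => //; exists k => //; rewrite divgK.
rewrite (conv_term_sum _ _ hM).
have E2 m : conv_term (groupoid_conv f f') xi c m =
    \sum_(k <- F') t (m * k^-1)%g k.
  rewrite /conv_term; case e : (arr_shift m^-1%g c) => [a|] /=; last first.
    rewrite big1 // => k _; rewrite /t.
    case eb : arr_shift => [b|] //=; case ea : arr_shift => [a|] //=.
    move: eb ea => /arr_shiftP [b1 b2] /arr_shiftP [a1 a2].
    have : arr_shift m^-1%g c = Some a.
      by apply/arr_shiftP; rewrite a2 b2 a1 b1 invgM invgK !mulgA mulVg mul1g.
    by rewrite e.
  rewrite (groupoid_convE _ hF') mulr_suml; apply: eq_bigr => k _; rewrite /t.
  case: ifPn => [/asboolP dk|/asboolP ndk].
    have [b eb] := arr_shift_dom dk.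
    have [_ tb] := arr_shift_tgt eb.
    have -> : arr_shift (m * k^-1)^-1%g c = Some b.
      move: e eb => /arr_shiftP [a1 a2] /arr_shiftP [b1 b2].
      by apply/arr_shiftP; rewrite b2 a2 b1 a1 invgM invgK mulgA.
    move/arr_shift_sym : eb => /= ->.
    by rewrite /= tb mulrA.
  (* Here [k] is undefined at the target of [a], and the term of [t] must vanish too: otherwise k^-1
     would carry some b to [a], so that k would be defined there. *)
  rewrite mul0r; case eb : arr_shift => [b|] //=; case ea : arr_shift => [a'|] //=.
  have aa : a' = a.
    move: e eb ea => /arr_shiftP [a1 a2] /arr_shiftP [b1 b2] /arr_shiftP [a1' a2'].
    apply: arr_ext; last by rewrite a2' b2 a2.
    by rewrite a1' b1 a1 invgM invgK !mulgA mulVg mul1g.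
  case: ndk; rewrite -aa.
  by move/arr_shift_symV : ea => /arr_shift_tgt [].
under [RHS]eq_bigr do rewrite E2.
rewrite exchange_big [RHS]exchange_big /=; rewrite big_seq [RHS]big_seq.
apply: eq_bigr => k kF'.
have <- : \sum_(h \in [set: G]) t h k = \sum_(h <- F) t h k.
  apply: fsbigTE => h hN; rewrite /t; case: arr_shift => [b|] //=.
  by case: arr_shift => [a|] //=; rewrite hF // mul0r.
have <- : \sum_(m \in [set: G]) t (m * k^-1)%g k = \sum_(m <- M) t (m * k^-1)%g k.
  apply: fsbigTE => m mN; rewrite /t; case: arr_shift => [b|] //=.
  case: arr_shift => [a|] //=; rewrite hF ?mul0r //.
  apply: contra mN => mkF; apply/imfset2P => /=.
  by exists (m * k^-1)%g => //; exists k => //; rewrite divgK.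
rewrite (reindex_fsbigT (fun m => m * k^-1)%g) //.
by exists (fun h => h * k)%g => m; rewrite ?mulgK ?divgK.
Qed.

Definition convolution_ops : set (L2 -> L2) :=
  [set T | bounded_op T /\ exists2 f, groupoid_Cc f & convolution_op f T].

Lemma convolution_ops_bounded : convolution_ops `<=` @bounded_op R arr.
Proof. by move=> T []. Qed.

Lemma boundary_algebra_closed : closed_subspace (boundary_algebra R P).
Proof.
apply: norm_closure_closed_subspace; first exact: convolution_ops_bounded.
- split; first exact: bounded_op0.
  exists (fun _ => 0); [exact: groupoid_Cc0|exact: convolution_op0].
- move=> S T [bS [f cf hf]] [bT [f' cf' hf']]; split; first exact: bounded_opD.
  by exists (fun x => f x + f' x); [exact: groupoid_CcD|exact: convolution_opD].
move=> z S [bS [f cf hf]]; split; first exact: bounded_opZ.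
by exists (fun x => z * f x); [exact: groupoid_CcZ|exact: convolution_opZ].
Qed.

Lemma boundary_algebra_comp S T : boundary_algebra R P S -> boundary_algebra R P T ->
  boundary_algebra R P (S \o T).
Proof.
apply: norm_closure_comp; first exact: convolution_ops_bounded.
move=> {}S {}T [bS [f cf hf]] [bT [f' cf' hf']]; split; first exact: bounded_op_comp.
by exists (groupoid_conv f f'); [exact: groupoid_Cc_conv|exact: convolution_op_comp].
Qed.

Lemma arr_shift_inj g : partial_injection (arr_shift g).
Proof. by move=> a a' b /arr_shift_sym + /arr_shift_sym => -> []. Qed.

(** Carries the mass at an arrow a to g.a, so the coordinate at c is read off at g^-1.c. *)
Definition translation g : L2 -> L2 := shift_op (arr_shift g^-1%g).

Lemma translationE g xi c : translation g xi c = oapp xi 0 (arr_shift g^-1%g c).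
Proof. exact/shift_opE/arr_shift_inj. Qed.

Lemma translation_bounded g : bounded_op (translation g).
Proof. exact/shift_op_bounded/arr_shift_inj. Qed.

Lemma translation_le g : op_le (translation g) 1.
Proof. exact/shift_op_le/arr_shift_inj. Qed.

Lemma translation_adjoint g : is_adjoint (translation g) (translation g^-1%g).
Proof.
apply: shift_op_adjoint => a b; rewrite invgK; exact: arr_shift_symV.
Qed.

(** The hypotheses say that, on the boundary, the domain of g is the cylinder of [X]. Its indicator
    is then in C_c, and convolution by it is the translation. *)
Lemma translation_algebra g X :
    (forall chi, boundary chi -> chi X -> act_dom g chi) ->
    (forall a b, arr_shift g a = Some b -> arr_tgt a X) ->
  boundary_algebra R P (translation g).
Proof.
move=> h1 h2; apply: norm_closure_subset; first exact: convolution_ops_bounded.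
split; first exact: translation_bounded.
exists (cylinder_bisection R g X); first exact: groupoid_Cc_cylinder.
apply/convolution_opE => xi c; rewrite translationE.
rewrite (@fsbigTE _ _ _ _ [fset g]%fset); last first.
  move=> h; rewrite inE => hg; rewrite /conv_term; case: arr_shift => //= b.
  rewrite /cylinder_bisection; case: asboolP => /=; last by rewrite mul0r.
  by move=> [e]; rewrite e eqxx in hg.
rewrite big_seq_fset1 /conv_term; case e : (arr_shift g^-1%g c) => [b|] //=.
rewrite /cylinder_bisection asboolT ?mul1r //=; split=> //; split.
  exact: arr_tgt_boundary.
by move/arr_shift_symV : e => /h2.
Qed.

Lemma translation_mul_algebra p : P p -> boundary_algebra R P (translation p).
Proof.
move=> Pp; apply: (@translation_algebra _ (cfull hP)) => [chi bc _|a b _].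
  by apply: act_dom_mul => //; exact: boundary_Jhat.
exact/Jhat_full/boundary_Jhat/arr_tgt_boundary.
Qed.

Lemma translation_inv_algebra p : P p -> boundary_algebra R P (translation p^-1%g).
Proof.
move=> Pp; apply: (@translation_algebra _ (principal Pp)) => [chi bc cp|a b e].
  by apply: act_dom_inv cp => //; exact: boundary_Jhat.
move/arr_shift_symV : e => /arr_shift_tgt [_ ->].
by apply: act_mul_principal => //; exact/boundary_Jhat/arr_tgt_boundary.
Qed.

Lemma translation_isometry p : P p -> translation p^-1%g \o translation p = id.
Proof.
move=> Pp; apply/funext => xi; apply: ell2P => c.
rewrite /= translationE invgK; have [b e] := arr_shift_mul c Pp.
by rewrite e /= translationE; move/arr_shift_sym : e => ->.
Qed.

Lemma translation_one : translation 1%g = id.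
Proof.
apply/funext => xi; apply: ell2P => c; rewrite translationE.
by rewrite (proj2 (arr_shiftP _ c c)) // invg1 mul1g.
Qed.

Lemma boundary_algebra_id : boundary_algebra R P id.
Proof. by rewrite -translation_one; exact: translation_mul_algebra (submonoid1 hP). Qed.

End BoundaryOperators.

(** * Compression to nearly scalar operators, and the conclusion *)

Section Compression.
Variables (R : realType) (G : groupType) (P : set G).
Hypothesis hP : monoid_closed (mem P).
Local Notation C := R[i].
Local Notation nrm := (@ComplexField.Normc.normc R).
Local Notation arr := (arrow P).
Local Notation L2 := (ell2 R arr).
Local Notation tr := (@translation R G P).
Implicit Types (chi psi : charJ P) (X Y Z : cset P) (g h k p q : G)
  (a b c : arr) (S T : L2 -> L2) (xi : L2)
  (f : discrete_topology G * charJ P -> R[i]^o).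

Lemma ell2_delta_norm_le1 (A : choiceType) (x : A) : ell2_norm (ell2_delta R x) <= 1.
Proof.
have h : ell2_norm (ell2_delta R x) ^+ 2 = 1.
  by apply: complexI; rewrite -ell2_dotxx ell2_dot_delta ell2_deltaE eqxx.
by rewrite -(@ler_pXn2r _ 2) ?nnegrE ?ell2_norm_ge0 // h expr1n.
Qed.

Lemma op_le_entry (A : choiceType) (T : ell2 R A -> ell2 R A) (M : R) x y :
  op_le T M -> nrm (T (ell2_delta R x) y) <= M.
Proof.
move=> [M0 hM]; apply: (le_trans (normc_le_ell2_norm _ _)).
apply: (le_trans (hM _)); rewrite -[leRHS]mulr1 ler_wpM2l //.
exact: ell2_delta_norm_le1.
Qed.

Lemma op_le_pointwise (A : choiceType) (T : ell2 R A -> ell2 R A) (M : R) : 0 <= M ->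
  (forall (xi : ell2 R A) x, nrm (T xi x) <= M * nrm (xi x)) -> op_le T M.
Proof.
move=> M0 h; split=> // xi; apply: ell2_norm_le => [|J].
  by rewrite mulr_ge0 ?ell2_norm_ge0.
apply: (@le_trans _ _ (\sum_(x <- J) M ^+ 2 * nrm (xi x) ^+ 2)).
  apply: ler_sum => x _; rewrite -exprMn.
  by rewrite ler_pXn2r ?nnegrE ?normc_ge0 ?mulr_ge0 ?normc_ge0.
by rewrite -mulr_sumr exprMn ler_wpM2l ?sqr_ge0 ?sum_le_ell2_norm.
Qed.

Lemma conv_term_delta f a c h : conv_term f (ell2_delta R a) c h != 0 ->
  arr_shift h^-1%g c = Some a /\ conv_term f (ell2_delta R a) c h = f (h, arr_tgt a).
Proof.
rewrite /conv_term; case e : (arr_shift _ c) => [b|]; rewrite /oapp ?eqxx //.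
rewrite ell2_deltaE; have [->|_] := eqVneq b a; last by rewrite mulr0 eqxx.
by rewrite mulr1.
Qed.

(** The matrix entry from a to c is the value of [f] at the arrow c a^-1; a non-zero entry
    guarantees that this arrow exists. *)
Lemma convolution_op_delta f S a c : groupoid_Cc f -> convolution_op f S ->
    S (ell2_delta R a) c != 0 ->
  let g := (arr_grp c * (arr_grp a)^-1)%g in
  arr_shift g a = Some c /\ S (ell2_delta R a) c = f (g, arr_tgt a).
Proof.
move=> /groupoid_Cc_support [F hF] /convolution_opE hS n0 g.
have hg h : arr_shift h^-1%g c = Some a -> h = g.
  by move=> /arr_shiftP [e _]; rewrite /g e invgM invgK mulVKg.
have e0 h : h != g -> conv_term f (ell2_delta R a) c h = 0.
  move=> hg'; apply: contra_neq_eq hg' => /conv_term_delta [/hg //].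
have SE : S (ell2_delta R a) c = conv_term f (ell2_delta R a) c g.
  rewrite hS (@fsbigTE _ _ _ _ [fset g]%fset) ?big_seq_fset1 // => h.
  by rewrite inE => /e0.
have [h1 h2] : arr_shift g^-1%g c = Some a /\
    conv_term f (ell2_delta R a) c g = f (g, arr_tgt a).
  by apply: conv_term_delta; rewrite -SE.
by split; [exact/arr_shift_symV|rewrite SE].
Qed.

Lemma compress T a c (lam : C) (e : R) : Gc P = [set 1%g] ->
    boundary_algebra R P T -> T (ell2_delta R a) c = lam -> lam != 0 -> 0 < e ->
  exists p q, [/\ P p, P q, q = (arr_grp c * (arr_grp a)^-1 * p)%g &
    op_le ((tr q^-1%g \o T \o tr p) - lam *: id) e].
Proof.
move=> Gc1 AT Tlam lam0 e0.
have nl : 0 < nrm lam.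
  rewrite lt_def normc_ge0 andbT; apply: contra_neq lam0.
  exact: ComplexField.Normc.eq0_normc.
(* A third of the error, and small enough to keep the approximating coefficient [mu] non-zero. *)
pose d := Num.min (e / 3) (nrm lam / 2).
have d0 : 0 < d by rewrite lt_min !divr_gt0.
have de : d <= e / 3 by rewrite ge_min lexx.
have dl : d <= nrm lam / 2 by rewrite ge_min lexx orbT.
have [bT apT] := proj1 (norm_closureP _ (@convolution_ops_bounded _ _ _)) AT.
have [S [bS [f cf hf]] hTS] := apT _ d0.
pose mu := S (ell2_delta R a) c.
have hmu : nrm (lam - mu) <= d.
  by rewrite -Tlam; exact: (op_le_entry a c hTS).
have mu0 : mu != 0.
  apply: contraTneq hmu => ->; rewrite subr0 -ltNge.
  by apply: le_lt_trans dl _; rewrite ltr_pdivrMr // ltr_pMr // ltr1n.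
have [ac muE] := convolution_op_delta cf hf mu0.
set g := (arr_grp c * (arr_grp a)^-1)%g in ac muE *.
have [dg _] := arr_shift_tgt hP ac.
have [[hc [s [hs [sg cs]]]] bc] := dg.
have [[F hF] cfP] := proj1 (groupoid_CcP f) cf.
have e3 : 0 < e / 3 by rewrite divr_gt0.
have [L hL] := proj1 (boundary_continuousP _) (cfP g).1 _ bc _ e3.
have [p [Pp [ps hp]]] := boundary_nbhs hP bc (nbhs_agree_on L (arr_tgt a)) cs.
(* the group elements [h^-1 * g] with [h <> g] in the support of [f] must be removed *)
have n1 : 1%g \notin [seq (h^-1 * g)%g | h <- F & h != g].
  apply/negP => /mapP [h]; rewrite mem_filter => /andP[hg _] e1.
  by case/eqP: hg; apply: (mulgI h^-1%g); rewrite mulVg.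
have [r Pr hr] := Gc1_disjoint_seq hP Gc1 n1 Pp.
have Ppr := submonoidM hP Pp Pr.
have prs : set_val (cdom hs) (p * r)%g by exact: cset_mulr.
(* [s] maps p r to g p r, and elements of the hull only relate elements of P. *)
have Pq : P (g * (p * r))%g.
  have [[x y] sxy /= xE] := prs; have [_] := hull_sub hP hs sxy.
  by have /= -> := sg.2 _ sxy; rewrite xE.
exists (p * r)%g, (g * (p * r))%g; split=> //.
set p' := (p * r)%g in Ppr prs Pq *; set q := (g * p')%g in Pq *.
pose V := tr p'; pose V' := tr q^-1%g.
have lV' : linear V' := bounded_op_linear (@translation_bounded R G P q^-1%g).
have -> : (V' \o T \o V) - lam *: id = (V' \o (T - S) \o V) +
    ((V' \o S \o V) - mu *: id) - (lam - mu) *: id.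
  apply/funext => xi.
  rewrite -[LHS]/(V' (T (V xi)) - lam *: xi).
  rewrite -[RHS]/(V' (T (V xi) - S (V xi)) + (V' (S (V xi)) - mu *: xi)
     - (lam - mu) *: xi) (linear_opB _ _ lV').
  by apply: ell2P => i; rewrite !(ell2D, ell2N, ell2Z); ring.
have -> : e = e / 3 + e / 3 + e / 3 by field.
apply: op_leB; last first.
  apply: op_le_weaken (op_leZ (lam - mu) (op_le_id _ _)) _.
  by rewrite mulr1; exact: le_trans hmu de.
apply: op_leD.
  have := op_le_comp (op_le_comp (@translation_le R G P q^-1%g) hTS) (@translation_le R G P p').
  by rewrite mul1r mulr1 => /op_le_weaken; exact.
(* Only the group element g survives the compression, so V' S V is a multiplication operator and a
   coordinatewise bound suffices. *)
apply: op_le_pointwise => [|xi x]; first exact: ltW.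
rewrite -[X in nrm X]/(V' (S (V xi)) x - mu * xi x).
have [x' xx'] := arr_shift_mul hP x Pq.
have [y xy] := arr_shift_mul hP x Ppr.
rewrite /V' translationE invgK xx' /oapp.
have SE : S (V xi) x' = f (g, arr_tgt y) * xi x.
  rewrite (proj1 (convolution_opE _ _) hf).
  rewrite (@fsbigTE _ _ _ _ [fset g]%fset); last first.
    move=> h; rewrite inE => hg; have [hFh|/hF h0] := boolP (h \in F); last first.
      by rewrite /conv_term; case: arr_shift => //= b; rewrite h0 mul0r.
    rewrite /conv_term; case eb : arr_shift => [b|] //=.
    rewrite translationE; case ez : arr_shift => [z|] /=; last by rewrite mulr0.
    have xz : arr_shift (p'^-1 * h^-1 * q)%g x = Some z.
      move: eb ez xx' => /arr_shiftP [b1 b2] /arr_shiftP [z1 z2] /arr_shiftP [x1 x2].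
      by apply/arr_shiftP; rewrite z2 b2 x2 z1 b1 x1 !mulgA.
    (* A surviving h <> g would make k = p'^-1 h^-1 g p' defined at a character, so that k u is in P
       for some u in P. Then p' (k u) = h^-1 g p' u contradicts the choice of r. *)
    have [[dk _] _] := arr_shift_tgt hP xz.
    have [u Pu Pku] := act_dom_meet hP dk.
    have hl : (h^-1 * g)%g \in [seq (h^-1 * g)%g | h <- F & h != g].
      by apply: map_f; rewrite mem_filter hg.
    case: (hr _ hl _ u Pku Pu); rewrite -/p' /q !mulgA.
    by rewrite mulgV mul1g.
  rewrite big_seq_fset1 /conv_term.
  have -> : arr_shift g^-1%g x' = Some y.
    move: xx' xy => /arr_shiftP [x1 x2] /arr_shiftP [y1 y2].
    by apply/arr_shiftP; rewrite y2 x2 y1 x1 /q -(mulgA g) mulKg.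
  rewrite /oapp /V translationE.
  by move/arr_shift_sym : xy => ->.
rewrite SE -mulrBl ComplexField.Normc.normcM ler_wpM2r ?normc_ge0 //.
(* The target of [y] is p' applied to that of [x], hence is 1 at p'P and at the larger pP, where
   f(g, -) stays within e/3 of [mu]. *)
have [_ yx] := arr_shift_tgt hP xy.
have by_ := arr_tgt_boundary hP y; have hy := boundary_Jhat by_.
rewrite /mu muE; apply: ltW; apply: hL => //.
apply: hp => //; have := act_mul_principal hP Ppr (boundary_Jhat (arr_tgt_boundary hP x)).
rewrite -yx; apply: Jhat_mono => //.
apply: principal_sub => //; apply: cset_mulr => //; exact: principal_mem.
Qed.

Lemma boundary_algebra_id_neq0 : (id : L2 -> L2) <> 0.
Proof.
have [chi bc _] := boundary_principal hP (submonoid1 hP).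
have [d1 _] := act_one hP (boundary_Jhat bc).
pose a := mk_arr (conj d1 bc) => h.
have := congr1 (fun T : L2 -> L2 => T (ell2_delta R a) a) h.
rewrite ell2_deltaE eqxx -[RHS]/(0 : C) => /eqP.
by rewrite oner_eq0.
Qed.

(** For p <> 1 in P there is q with qP and pqP disjoint. At the unit arrow of a character with
    chi(pqP) = 1, the equality v_q v_q^* = id would put chi in the domain of q^-1 and so produce a
    point of pqP in qP. *)
Lemma translation_nonunitary : Gc P = [set 1%g] -> P <> [set 1%g] ->
  exists2 q, P q & tr q \o tr q^-1%g <> id.
Proof.
move=> Gc1 nP.
have [p Pp p1] : exists2 p, P p & p <> 1%g.
  apply: contrapT => /forall2NP h; apply: nP; apply/seteqP; split=> [p Pp|_ ->].
    by have [//|/contrapT] := h p.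
  exact: submonoid1.
have [q Pq hq] := Gc1_disjoint Gc1 p1 (submonoid1 hP).
exists q => // h.
have Ppq := submonoidM hP Pp Pq.
have [chi bc cp] := boundary_principal hP Ppq.
have hc := boundary_Jhat bc.
have [d1 _] := act_one hP hc.
pose a := mk_arr (conj d1 bc).
have := congr1 (fun T : L2 -> L2 => T (ell2_delta R a) a) h.
rewrite ell2_deltaE eqxx /= translationE.
case e : arr_shift => [b|]; rewrite /oapp; last first.
  by move=> /esym/eqP; rewrite oner_eq0.
move/arr_shiftP : e => [e1 e2]; have [db _] := arr_dom b.
rewrite e1 e2 mulg1 in db.
have [_ [s [hs [sg cs]]]] := db.
have [x [x1 /principalE [z Pz xpq]]] := Jhat_nonempty hc (JhatI hc cs cp).
have [[x' y] sxy /= xE] : pdom s x := x1.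
have [_ Py] := hull_sub hP hs sxy; have /= yE := sg.2 _ sxy.
case: (hq y z Py Pz); rewrite !mul1g yE xE xpq !mulgA mulgV mul1g.
by [].
Qed.

Lemma boundary_algebra_simple : Gc P = [set 1%g] ->
  Cstar_simple (boundary_algebra R P).
Proof.
move=> Gc1; apply: simple_criterion.
- exact: boundary_algebra_id.
- exact: boundary_algebra_id_neq0.
move=> T AT T0.
have [a [c n0]] : exists a c, T (ell2_delta R a) c <> 0.
  apply: contrapT => h; apply: T0; apply: bounded_op_delta_eq0; first by case: AT.
  move=> a; apply: ell2P => c; rewrite ell20; apply: contrapT => n0.
  by apply: h; exists a, c.
have nl : 0 < nrm (T (ell2_delta R a) c) * 2^-1.
  rewrite mulr_gt0 ?invr_gt0 // lt_def normc_ge0 andbT; apply/eqP.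
  by move=> /ComplexField.Normc.eq0_normc.
have [p [q [Pp Pq _ hpq]]] := compress Gc1 AT erefl (introN eqP n0) nl.
exists (tr p), (tr q^-1%g); split.
- exact: translation_mul_algebra.
- exact: translation_inv_algebra.
by exists (T (ell2_delta R a) c).
Qed.

Lemma boundary_algebra_purely_infinite : Gc P = [set 1%g] -> P <> [set 1%g] ->
  purely_infinite_simple (boundary_algebra R P).
Proof.
move=> Gc1 nP; split; first exact: boundary_algebra_simple.
apply: purely_infinite_criterion.
- exact: boundary_algebra_closed.
- exact: boundary_algebra_id.
- exact: boundary_algebra_comp.
- move=> T a e AT T1 e0.
  have [p [q [Pp Pq]]] := compress Gc1 AT T1 (oner_neq0 _) e0.
  rewrite mulgV mul1g scale1r => qp; rewrite qp => hp.
  exists (tr p), (tr p^-1%g); split.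
  + exact: translation_mul_algebra.
  + exact: translation_inv_algebra.
  + exact: translation_adjoint.
  + exact: translation_isometry.
  + exact: hp.
have [q Pq hq] := translation_nonunitary Gc1 nP.
exists (tr q), (tr q^-1%g); split.
- exact: translation_mul_algebra.
- exact: translation_inv_algebra.
- exact: translation_adjoint.
- exact: translation_isometry.
- exact: hq.
Qed.

End Compression.

Theorem theorem1 (R : realType) (G : groupType) (P : set G)
    (hP : monoid_closed (mem P)) :
  (topologically_free P <-> Gc P = [set 1%g]%classic) /\
  (Gc P = [set 1%g]%classic ->
    Cstar_simple (boundary_algebra R P) /\
    (P <> [set 1%g]%classic ->
      purely_infinite_simple (boundary_algebra R P))).
Proof.
split; first exact: topologically_freeP.
move=> Gc1; split; first exact: boundary_algebra_simple.
exact: boundary_algebra_purely_infinite.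
Qed.
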